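(* Let $(X,s)$ be a factor of $(\mathcal{H},T)$. Then the system $(E(X,s),\lambda_s)$ has quasi-discrete spectrum.
   Context: A dynamical system is a pair $(X,s)$ with $X$ a compact Hausdorff space and $s:X\to X$ a homeomorphism. $(Y,t)$ is a factor of $(X,s)$ if there is a continuous surjection $\pi:X\to Y$ with $\pi\circ s=t\circ\pi$. The enveloping semigroup $E(X,s)$ is the closure of $\{s^n:n\in\mathbb{Z}\}$ in the product space $X^X$; $(E(X,s),\lambda_s)$ is the dynamical system with $\lambda_s(a)=s\circ a$. $\mathbb{T}$ is the unit circle in $\mathbb{C}$; $\mathcal{C}(X)$ is the algebra of continuous complex functions on $X$ (supremum norm); $\mathcal{C}(X,\mathbb{T})$ the multiplicative group of continuous functions $X\to\mathbb{T}$; $s^*f=f\circ s$. Let $G_0(X,s)$ be the constant functions $X\to\mathbb{T}$, $G_{m+1}(X,s)=\{g\in\mathcal{C}(X,\mathbb{T}): s^*g=fg\text{ for some }f\in G_m(X,s)\}$, $G(X,s)=\bigcup_{m\ge0}G_m(X,s)$. $(X,s)$ has (topological) quasi-discrete spectrum if the linear span of $G(X,s)$ is dense in $\mathcal{C}(X)$. $\mathbb{N}=\{1,2,\ldots\}$, $\mathbb{Z}_+=\{0,1,\ldots\}$; $\mathbb{T}_Q=\{e^{i2\pi q}:q\in\mathbb{Q}\}$. $H(\mathbb{T})$ is the set of all (not necessarily continuous) group homomorphisms $\mathbb{T}\to\mathbb{T}$, with pointwise multiplication and the topology of pointwise convergence. $\phi^{(j)}$ denotes the $j$-fold composition of $\phi$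 with itself; $s(k,j)$ are the (signed) Stirling numbers of the first kind: $n(n-1)\cdots(n-k+1)=\sum_{j=0}^k s(k,j)n^j$. $\mathcal{H}$ is the set of all $(\phi_k)_{k=0}^\infty\in H(\mathbb{T})^{\mathbb{Z}_+}$ with $\phi_0=\mathrm{id}_{\mathbb{T}}$ and $\phi_k(x^{k!})=\prod_{j=1}^k\phi_1^{(j)}(x^{s(k,j)})$ for all $x\in\mathbb{T}_Q$, $k\in\mathbb{N}$, a compact space in the subspace topology of the product. $T:\mathcal{H}\to\mathcal{H}$ is the homeomorphism $T(\phi_0,\phi_1,\phi_2,\ldots)=(\phi_0,\phi_0\phi_1,\phi_1\phi_2,\ldots)$ (pointwise products). *)

(* Defs.v *)
From HB Require Import structures.
From mathcomp Require Import all_boot all_order all_algebra.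
From mathcomp Require Import complex ring lra.
From mathcomp Require Import all_classical all_reals.
From mathcomp Require Import all_analysis.

Set Implicit Arguments.
Unset Strict Implicit.
Unset Printing Implicit Defensive.

Import Order.TTheory GRing.Theory Num.Theory.
Import numFieldNormedType.Exports.

Local Open Scope classical_set_scope.
Local Open Scope ring_scope.
Local Open Scope complex_scope.
Lemma set_val_continuous (X : topologicalType) (A : set X) :
  continuous (set_val : A -> X).
Proof. exact: initial_continuous. Qed.

Lemma set_val_continuousP (X Y : topologicalType) (A : set X) (f : Y -> A) :
  continuous (set_val \o f) -> continuous f.
Proof. by move=> cf; exact: (@continuous_comp_initial _ _ _ set_val). Qed.

Lemma set_val_inj (X : Type) (A : set X) : injective (set_val : A -> X).
Proof. exact: val_inj. Qed.

Lemma compact_set_type (X : topologicalType) (A : set X) :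
  compact A -> compact [set: A].
Proof.
move=> cA F PF _.
have FA : (set_val @ F) A.
  rewrite /fmap /= (_ : _ @^-1` A = [set: A]); first exact: filterT.
  by rewrite eqEsubset; split => // x _; exact: set_valP.
have [x [Ax clx]] := cA (set_val @ F) _ FA.
exists (SigSub (mem_set Ax)); split => // B C FB [D [[W oW WD] Dx DC]].
have [||y [[b Bb <-] Wb]] := clx (set_val @` B) W.
- by apply: (@filterS _ F _ B) => // z Bz; exists z.
- by apply: open_nbhs_nbhs; split => //; move: Dx; rewrite -WD.
- by exists b; split => //; apply: DC; rewrite -WD.
Qed.

Lemma hausdorff_inj (X Y : topologicalType) (f : X -> Y) :
  continuous f -> injective f -> hausdorff_space Y -> hausdorff_space X.
Proof.
move=> cf fi hY x y cxy; apply: fi; apply: hY => A B fA fB.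
have [z [/= Az Bz]] := cxy _ _ (cf _ _ fA) (cf _ _ fB).
by exists (f z).
Qed.

Lemma hausdorff_set_type (X : topologicalType) (A : set X) :
  hausdorff_space X -> hausdorff_space A.
Proof. exact/hausdorff_inj/set_val_inj/set_val_continuous. Qed.

Lemma ptws_eval_continuous (U : eqType) (V : topologicalType) (u : U) :
  continuous ((fun f => f u) : {ptws U -> V} -> V).
Proof. exact: (@proj_continuous U (fun=> V) u). Qed.

Lemma ptws_continuousP (U : Type) (Y V : topologicalType)
  (f : Y -> {ptws U -> V}) :
  (forall u, continuous (fun y => f y u)) -> continuous f.
Proof.
move=> cf y; apply/cvg_sup => u.
apply: (@continuous_comp_initial _ _ _ (fun g : U -> V => g u)).
exact: cf.
Qed.

Lemma ptws_compact (U : eqType) (V : topologicalType) :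
  compact [set: V] -> compact [set: {ptws U -> V}].
Proof.
move=> cV; have := @tychonoff U (fun=> V) (fun=> setT) (fun=> cV).
by rewrite (_ : [set f | _] = setT) // eqEsubset; split.
Qed.

Lemma ptws_hausdorff (U : eqType) (V : topologicalType) :
  hausdorff_space V -> hausdorff_space {ptws U -> V}.
Proof. by move=> hV; exact: (@hausdorff_product U (fun=> V)). Qed.

Lemma closed_eq_hausdorff (X Y : topologicalType) (f g : X -> Y) :
  hausdorff_space Y -> continuous f -> continuous g ->
  closed [set x | f x = g x].
Proof.
move=> hY cf cg x clx; apply: hY => A B fA gB.
have nAB : nbhs x (f @^-1` A `&` g @^-1` B).
  by apply: filterI; [exact: cf|exact: cg].
have [y /= [fgy [Ay By]]] := clx _ nAB.
by exists (f y); split => //; rewrite fgy.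
Qed.

Lemma closure_stable (X : topologicalType) (f : X -> X) (A : set X) (x : X) :
  continuous f -> (forall a, A a -> A (f a)) -> closure A x -> closure A (f x).
Proof.
move=> cf fA clx B fB; have [y [Ay By]] := clx _ (cf _ _ fB).
by exists (f y); split => //; exact: fA.
Qed.

(* The homeomorphism [dyn] is stored together with its (unique) continuous
   inverse [dyn_inv], so that its integer powers can be written down. *)
Record dynSys := DynSys {
  space :> topologicalType;
  dyn : space -> space;
  dyn_inv : space -> space;
  space_compact : compact [set: space];
  space_hausdorff : hausdorff_space space;
  dyn_continuous : continuous dyn;
  dyn_inv_continuous : continuous dyn_inv;
  dynK : cancel dyn dyn_inv;
  dyn_invK : cancel dyn_inv dyn }.

Definition factor_of (Y X : dynSys) : Prop :=
  exists pi : X -> Y,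
    [/\ continuous pi, set_surj setT setT pi
      & forall x, pi (dyn x) = dyn (pi x)].

Definition dyn_iter (X : dynSys) (n : int) : X -> X :=
  match n with
  | Posz k => iter k (@dyn X)
  | Negz k => iter k.+1 (@dyn_inv X)
  end.

Definition enveloping (X : dynSys) : set {ptws X -> X} :=
  closure (range (@dyn_iter X) : set {ptws X -> X}).
Arguments enveloping X : clear implicits.

Lemma dyn_iterS (X : dynSys) (n : int) :
  @dyn X \o @dyn_iter X n = @dyn_iter X (n + 1).
Proof.
apply/funext => x; case: n => n.
  by have -> : Posz n + 1 = Posz n.+1 by rewrite -addn1.
have -> : Negz n + 1 = - Posz n by rewrite NegzE -[n.+1]addn1 PoszD opprD subrK.
rewrite /= dyn_invK; case: n => [|n]; first by rewrite oppr0.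
by rewrite -NegzE.
Qed.

Lemma dyn_iterB (X : dynSys) (n : int) :
  @dyn_inv X \o @dyn_iter X n = @dyn_iter X (n - 1).
Proof.
have -> : @dyn_iter X n = @dyn X \o @dyn_iter X (n - 1).
  by rewrite dyn_iterS subrK.
by apply/funext => x /=; rewrite dynK.
Qed.

Lemma postcomp_continuous (U : eqType) (V : topologicalType) (f : V -> V) :
  continuous f -> continuous ((fun a => f \o a) : {ptws U -> V} -> {ptws U -> V}).
Proof.
move=> cf; apply: (@ptws_continuousP U {ptws U -> V} V) => u /= a.
by apply: continuous_comp; [exact: ptws_eval_continuous|exact: cf].
Qed.

Lemma enveloping_dyn (X : dynSys) (a : {ptws X -> X}) :
  enveloping X a -> enveloping X (@dyn X \o a : {ptws X -> X}).
Proof.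
apply: (closure_stable (postcomp_continuous (@dyn_continuous X))).
by move=> _ [n _ <-]; exists (n + 1) => //; rewrite dyn_iterS.
Qed.

Lemma enveloping_dyn_inv (X : dynSys) (a : {ptws X -> X}) :
  enveloping X a -> enveloping X (@dyn_inv X \o a : {ptws X -> X}).
Proof.
apply: (closure_stable (postcomp_continuous (@dyn_inv_continuous X))).
by move=> _ [n _ <-]; exists (n - 1) => //; rewrite dyn_iterB.
Qed.

Definition lambda (X : dynSys) (a : enveloping X) : enveloping X :=
  SigSub (mem_set (enveloping_dyn (set_valP a))).

Definition lambda_inv (X : dynSys) (a : enveloping X) : enveloping X :=
  SigSub (mem_set (enveloping_dyn_inv (set_valP a))).

Section EnvelopingSystem.
Variable X : dynSys.

Let env_compact : compact [set: enveloping X].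
Proof.
apply: compact_set_type; apply: (subclosed_compact (@closed_closure _ _)).
  exact: ptws_compact (@space_compact X).
exact: subsetT.
Qed.

Let env_hausdorff : hausdorff_space (enveloping X).
Proof. exact/hausdorff_set_type/ptws_hausdorff/space_hausdorff. Qed.

Let lambda_continuous : continuous (@lambda X).
Proof.
apply: set_val_continuousP => a /=.
apply: (@continuous_comp _ _ _ set_val
  (fun b : {ptws X -> X} => @dyn X \o b : {ptws X -> X})).
  exact: set_val_continuous.
exact/postcomp_continuous/dyn_continuous.
Qed.

Let lambda_inv_continuous : continuous (@lambda_inv X).
Proof.
apply: set_val_continuousP => a /=.
apply: (@continuous_comp _ _ _ set_val
  (fun b : {ptws X -> X} => @dyn_inv X \o b : {ptws X -> X})).
  exact: set_val_continuous.
exact/postcomp_continuous/dyn_inv_continuous.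
Qed.

Let lambdaK : cancel (@lambda X) (@lambda_inv X).
Proof. by move=> a; apply/set_val_inj/funext => x; exact: dynK. Qed.

Let lambda_invK : cancel (@lambda_inv X) (@lambda X).
Proof. by move=> a; apply/set_val_inj/funext => x; exact: dyn_invK. Qed.

Definition enveloping_system : dynSys :=
  DynSys env_compact env_hausdorff lambda_continuous lambda_inv_continuous
    lambdaK lambda_invK.

End EnvelopingSystem.

(* [R[i]^o] is [R[i]] with the topology induced by the complex modulus. *)
Notation Cplx R := (R[i]^o).

Definition unit_circle (R : realType) : set (Cplx R) := [set z | `|z| = 1].

Definition circle (R : realType) : Type := set_type (@unit_circle R).

HB.instance Definition _ (R : realType) :=
  Topological.copy (circle R) (set_type (@unit_circle R)).

Definition cval (R : realType) (x : circle R) : Cplx R := set_val x.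
Arguments cval {R} x.

Section CircleGroup.
Variable R : realType.
Implicit Types x y : circle R.

Lemma cval_norm x : `|cval x| = 1. Proof. exact: (set_valP x). Qed.

Lemma cval_inj : injective (@cval R). Proof. exact: set_val_inj. Qed.

Lemma cval_neq0 x : cval x != 0.
Proof. by rewrite -normr_eq0 cval_norm oner_eq0. Qed.

Definition mk_circle (z : Cplx R) (hz : `|z| = 1) : circle R :=
  SigSub (mem_set hz : z \in @unit_circle R).

Let mul_proof x y : `|cval x * cval y| = 1.
Proof. by rewrite normrM !cval_norm mulr1. Qed.

Let inv_proof x : `|(cval x)^-1| = 1.
Proof. by rewrite normfV cval_norm invr1. Qed.

Definition circle_one := mk_circle (normr1 (Cplx R)).
Definition circle_mul x y := mk_circle (mul_proof x y).
Definition circle_inv x := mk_circle (inv_proof x).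

Let circle_mulA : associative circle_mul.
Proof. by move=> x y z; apply: cval_inj; exact: mulrA. Qed.
Let circle_mul1 : left_id circle_one circle_mul.
Proof. by move=> x; apply: cval_inj; exact: mul1r. Qed.
Let circle_1mul : right_id circle_one circle_mul.
Proof. by move=> x; apply: cval_inj; exact: mulr1. Qed.
Let circle_mulV : left_inverse circle_one circle_inv circle_mul.
Proof. by move=> x; apply: cval_inj; apply/mulVf/cval_neq0. Qed.
Let circle_Vmul : right_inverse circle_one circle_inv circle_mul.
Proof. by move=> x; apply: cval_inj; apply/mulfV/cval_neq0. Qed.

HB.instance Definition _ := isGroup.Build (circle R)
  circle_mulA circle_mul1 circle_1mul circle_mulV circle_Vmul.

End CircleGroup.

Definition circle_expz (R : realType) (x : circle R) (n : int) : circle R :=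
  match n with
  | Posz k => (x ^+ k)%g
  | Negz k => (x ^- k.+1)%g
  end.
Notation "x ^z n" := (circle_expz x n) (at level 29, left associativity).

Definition expi (R : realType) (t : R) : Cplx R := cos t +i* sin t.

Definition rational_circle (R : realType) : set (circle R) :=
  [set x | exists q : rat, cval x = expi (2 * pi * ratr q)].

Section CircleTheory.
Variable R : realType.
Implicit Types x y : circle R.

Lemma cvalM x y : cval (x * y)%g = cval x * cval y. Proof. by []. Qed.
Lemma cval1 : cval (1%g : circle R) = 1. Proof. by []. Qed.
Lemma cvalV x : cval (x^-1)%g = (cval x)^-1. Proof. by []. Qed.
Lemma cvalX x n : cval (x ^+ n)%g = cval x ^+ n.
Proof. by elim: n => // n IH; rewrite expgS exprS cvalM IH. Qed.
Lemma cvalXz x (n : int) : cval (x ^z n) = (cval x : R[i]) ^ n.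
Proof. by case: n => n; rewrite /= ?cvalV cvalX. Qed.

Lemma circle_mulC x y : (x * y = y * x)%g.
Proof. by apply: cval_inj; exact: mulrC. Qed.

Lemma circle_expM x (m n : nat) : (x ^+ (m * n))%g = ((x ^+ m) ^+ n)%g.
Proof. by apply: cval_inj; rewrite !cvalX exprM. Qed.

Lemma circle_expzM x (m n : int) : x ^z (m * n) = x ^z m ^z n.
Proof. by apply: cval_inj; rewrite !cvalXz exprz_exp. Qed.

Lemma circle_expzD x (m n : int) : x ^z (m + n) = (x ^z m * x ^z n)%g.
Proof. by apply: cval_inj; rewrite cvalM !cvalXz expfzDr// cval_neq0. Qed.

Lemma circle_expz_sum x (I : Type) (r : seq I) (F : I -> int) :
  x ^z (\sum_(i <- r) F i) = (\prod_(i <- r) x ^z F i)%g.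
Proof.
elim: r => [|i r IH]; first by rewrite !big_nil.
by rewrite !big_cons circle_expzD IH.
Qed.

Lemma cval_continuous : continuous (@cval R).
Proof. exact: set_val_continuous. Qed.

Lemma circle_hausdorff : hausdorff_space (circle R).
Proof.
apply: (hausdorff_inj cval_continuous (@cval_inj R)).
exact: (@norm_hausdorff _ (Cplx R)).
Qed.

Lemma circle_mul_continuous (T : topologicalType) (f g : T -> circle R) :
  continuous f -> continuous g -> continuous (fun t => (f t * g t)%g).
Proof.
move=> cf cg; apply: set_val_continuousP => t.
apply: (@continuousM R[i] T (cval \o f) (cval \o g)).
  by apply: continuous_comp; [exact: cf|exact: cval_continuous].
by apply: continuous_comp; [exact: cg|exact: cval_continuous].
Qed.

Lemma circle_inv_continuous (T : topologicalType) (f : T -> circle R) :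
  continuous f -> continuous (fun t => (f t)^-1%g).
Proof.
move=> cf; apply: set_val_continuousP => t.
apply: (@continuousV R[i] T (cval \o f)); first exact: cval_neq0.
by apply: continuous_comp; [exact: cf|exact: cval_continuous].
Qed.

Lemma real_complex_continuous : continuous (fun a : R => a%:C : Cplx R).
Proof.
move=> a; apply/(@cvgrPdist_lt _ (Cplx R)) => e e0.
have [Ie Re0] : complex.Im e = 0 /\ 0 < complex.Re e.
  by move: e0; rewrite ltcE /= => /andP[/eqP].
near=> b.
rewrite -rmorphB normc_def /= expr0n /= addr0 sqrtr_sqr ltcE /= Ie eqxx /=.
near: b; exact: (@cvgr_dist_lt _ _ _ (nbhs a) _ id a cvg_id _ Re0).
Unshelve. all: by end_near. Qed.

Lemma circle_compact : compact [set: circle R].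
Proof.
apply: compact_set_type.
pose f (p : R * R) : Cplx R := p.1 +i* p.2.
have cf : continuous f.
  have -> : f = (fun p => (p.1)%:C + ('i : Cplx R) * (p.2)%:C).
    by apply/funext => p; rewrite [LHS]complexE.
  move=> p; apply: (@continuousD R[i] (Cplx R) _ (fun p : R * R => p.1%:C) (fun p => ('i : Cplx R) * (p.2)%:C)).
    apply: (@continuous_comp _ _ _ fst (fun a : R => a%:C : Cplx R)).
      exact: cvg_fst.
    exact: real_complex_continuous.
  apply: (@continuousM R[i] _ (fun=> 'i) (fun p : R * R => p.2%:C)); first exact: cst_continuous.
  apply: (@continuous_comp _ _ _ snd (fun a : R => a%:C : Cplx R)).
    exact: cvg_snd.
  exact: real_complex_continuous.
apply: (@subclosed_compact _ _ (f @` (`[-1, 1] `*` `[-1, 1]))).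
- rewrite (_ : @unit_circle R = [set z : Cplx R | (`|z| : Cplx R) = 1]) //.
  apply: closed_eq_hausdorff; first exact: (@norm_hausdorff _ (Cplx R)).
    exact: (@norm_continuous _ (Cplx R)).
  exact: cst_continuous.
- apply: continuous_compact; first exact: continuous_subspaceT.
  by apply: compact_setX; exact: segment_compact.
- move=> [a b] /= ; rewrite /unit_circle /= => hz.
  have ab : a ^+ 2 + b ^+ 2 = 1.
    by have /eqP := add_Re2_Im2 (a +i* b); rewrite hz expr1n eq_complex /=;
      case/andP=> /eqP.
  exists (a, b) => //=; rewrite !in_itv /=; split; apply/andP; split; nra.
Qed.

Lemma expiD (s t : R) : expi (s + t) = expi s * expi t.
Proof.
rewrite /expi cosD sinD; apply/eqP; rewrite eq_complex /=.
by apply/andP; split => //; apply/eqP; ring.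
Qed.

Lemma expiMn (t : R) n : expi (t *+ n) = expi t ^+ n.
Proof.
elim: n => [|n IH]; first by rewrite mulr0n expr0 /expi cos0 sin0.
by rewrite mulrS exprS expiD IH.
Qed.

Lemma expi2pi_int (n : int) : expi (2 * pi * n%:~R : R) = 1.
Proof.
have e2 : expi (2 * pi : R) = 1.
  by rewrite /expi mulr_natl cos2pi mulr2n sinDpi sinpi oppr0.
have en k : expi (2 * pi * k%:R : R) = 1.
  by rewrite mulr_natr expiMn e2 expr1n.
case: n => n; first exact: en.
have : expi (2 * pi * (Negz n)%:~R : R) * expi (2 * pi * n.+1%:R) = 1.
  by rewrite -expiD NegzE mulrNz -mulrDr addNr mulr0 /expi cos0 sin0.
by rewrite en mulr1.
Qed.

Lemma rational_circle_torsion x :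
  rational_circle x -> exists2 N, (0 < N)%N & (x ^+ N)%g = 1%g.
Proof.
move=> [q xq]; exists `|denq q|%N; first by rewrite absz_gt0 denq_neq0.
apply: cval_inj; rewrite cvalX xq -expiMn cval1 -(expi2pi_int (numq q)).
congr expi; rewrite -[LHS]mulr_natr -mulrA; congr (_ * _).
have d0 : (denq q)%:~R != 0 :> R by rewrite intr_eq0 denq_neq0.
rewrite /ratr (_ : `|denq q|%:R = (denq q)%:~R :> R) ?divfK//.
by rewrite -[in RHS](gtz0_abs (denq_gt0 q)).
Qed.

End CircleTheory.

Definition circle_hom (R : realType) : set {ptws circle R -> circle R} :=
  [set phi : {ptws circle R -> circle R}
    | forall x y, phi (x * y)%g = (phi x * phi y)%g].
Arguments circle_hom R : clear implicits.

Definition Hom (R : realType) : Type := set_type (circle_hom R).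

HB.instance Definition _ (R : realType) :=
  Topological.copy (Hom R) (set_type (circle_hom R)).

Definition happ (R : realType) (phi : Hom R) : circle R -> circle R :=
  set_val phi.
Coercion happ : Hom >-> Funclass.

Section HomTheory.
Variable R : realType.
Implicit Types (phi psi : Hom R) (x y : circle R).

Lemma homM phi x y : phi (x * y)%g = (phi x * phi y)%g.
Proof. exact: (set_valP phi). Qed.

Lemma hom_ext phi psi : (forall x, phi x = psi x) -> phi = psi.
Proof. by move=> h; apply/set_val_inj/funext. Qed.

Definition mk_hom (f : circle R -> circle R)
    (hf : forall x y, f (x * y)%g = (f x * f y)%g) : Hom R :=
  SigSub (mem_set hf : (f : {ptws circle R -> circle R}) \in circle_hom R).

Let mul_proof phi psi x y :
  (phi (x * y) * psi (x * y) = (phi x * psi x) * (phi y * psi y))%g.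
Proof. by apply: cval_inj; rewrite !homM !cvalM; ring. Qed.

Let div_proof phi psi x y :
  (phi (x * y) * (psi (x * y))^-1
    = (phi x * (psi x)^-1) * (phi y * (psi y)^-1))%g.
Proof. by apply: cval_inj; rewrite !homM !cvalM !cvalV !cvalM invfM; ring. Qed.

Definition hom_mul phi psi : Hom R := mk_hom (mul_proof phi psi).
Definition hom_div phi psi : Hom R := mk_hom (div_proof phi psi).

Lemma hom_mulE phi psi x : hom_mul phi psi x = (phi x * psi x)%g.
Proof. by []. Qed.

Lemma hom_divE phi psi x : hom_div phi psi x = (phi x * (psi x)^-1)%g.
Proof. by []. Qed.

Lemma hom1 phi : phi 1%g = 1%g.
Proof.
apply: cval_inj; apply: (mulfI (cval_neq0 (phi 1%g))).
by rewrite -cvalM -homM mul1g cval1 mulr1.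
Qed.

Lemma homX phi x n : phi (x ^+ n)%g = (phi x ^+ n)%g.
Proof. by elim: n => [|n IH]; rewrite ?hom1// !expgS homM IH. Qed.

Lemma homV phi x : phi (x^-1)%g = (phi x)^-1%g.
Proof.
apply: cval_inj; apply: (mulfI (cval_neq0 (phi x))).
by rewrite -!cvalM -homM !mulgV hom1.
Qed.

Lemma homXz phi x (n : int) : phi (x ^z n) = phi x ^z n.
Proof. by case: n => n; rewrite /= ?homV homX. Qed.

Lemma hom_torsion phi x N : (0 < N)%N -> (x ^+ N)%g = 1%g ->
  exists2 n : nat, (n < N)%N & phi x = (x ^+ n)%g.
Proof.
move=> N0 xN; have cxN : (cval x : R[i]) ^+ N = 1 by rewrite -cvalX xN.
have [m mx mN] := prim_order_exists N0 cxN.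
have px : (cval (phi x) : R[i]) ^+ m = 1.
  rewrite -cvalX -homX (_ : (x ^+ m)%g = 1%g) ?hom1//.
  by apply: cval_inj; rewrite cvalX (prim_expr_order mx).
have [i hi] := prim_rootP mx px.
exists i; first by rewrite (leq_trans (ltn_ord i))// dvdn_leq.
by apply: cval_inj; rewrite cvalX.
Qed.

Lemma hom_eval_continuous x : continuous (fun phi : Hom R => phi x).
Proof.
move=> phi; apply: (@continuous_comp _ _ _ set_val
  (fun f : {ptws circle R -> circle R} => f x)).
  exact: set_val_continuous.
exact: ptws_eval_continuous.
Qed.

Lemma hom_continuousP (Y : topologicalType) (F : Y -> Hom R) :
  (forall x, continuous (fun t => F t x)) -> continuous F.
Proof.
move=> cF; apply: set_val_continuousP.
exact: (@ptws_continuousP _ _ _ (fun t => set_val (F t))).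
Qed.

Lemma hom_eval_near phi x N : (0 < N)%N -> (x ^+ N)%g = 1%g ->
  nbhs phi [set psi : Hom R | psi x = phi x].
Proof.
move=> N0 xN.
pose S := [set (x ^+ i)%g | i in `I_N] `\ phi x.
have clS : closed S.
  have /hausdorff_accessible/accessible_finite_set_closed := @circle_hausdorff R.
  by apply; apply: finite_setD; exact/finite_image/finite_II.
have nS : nbhs (phi x) (~` S).
  apply: open_nbhs_nbhs; split; first exact: closed_openC.
  by case=> _ /=; apply.
have nS' : nbhs phi [set psi : Hom R | (~` S) (psi x)].
  exact: (hom_eval_continuous nS).
move: nS'; apply: filterS => psi /= Spsi.
have [n nN psix] := hom_torsion psi N0 xN.
apply: contrapT => ne; apply: Spsi; split => //.
by exists n.
Qed.

Lemma hom_iter_torsion phi x N j :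
  (x ^+ N)%g = 1%g -> (iter j phi x ^+ N)%g = 1%g.
Proof. by move=> xN; elim: j => //= j IH; rewrite -homX IH hom1. Qed.

Lemma hom_iter_continuous x N j : (0 < N)%N -> (x ^+ N)%g = 1%g ->
  continuous (fun phi : Hom R => iter j phi x).
Proof.
move=> N0 xN.
have H i (phi : Hom R) : nbhs phi [set psi : Hom R | iter i psi x = iter i phi x].
  elim: i => [|i IH]; first exact: filterE.
  have := hom_eval_near phi N0 (hom_iter_torsion phi i xN).
  by move: IH; apply: filterS2 => psi /= ->.
move=> phi A /nbhs_singleton Aphi; by move: (H j phi); apply: filterS => psi /= ->.
Qed.

Lemma circle_prod_continuous (Y : topologicalType) (I : Type) (r : seq I)
  (F : I -> Y -> circle R) :
  (forall i, continuous (F i)) ->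
  continuous (fun t => (\prod_(i <- r) F i t)%g).
Proof.
move=> cF; elim: r => [|i r IH].
  rewrite (_ : (fun t => _) = fun=> 1%g); first exact: cst_continuous.
  by apply/funext => t; rewrite big_nil.
rewrite (_ : (fun t => _) = fun t => (F i t * \prod_(i <- r) F i t)%g).
  exact: circle_mul_continuous.
by apply/funext => t; rewrite big_cons.
Qed.

Lemma hom_compact : compact [set: Hom R].
Proof.
apply: compact_set_type.
apply: (@subclosed_compact _ _ [set: {ptws circle R -> circle R}]) => //.
  rewrite (_ : circle_hom R = \bigcap_x \bigcap_y [set phi
    : {ptws circle R -> circle R} | phi (x * y)%g = (phi x * phi y)%g]).
    apply: closed_bigI => x _; apply: closed_bigI => y _.
    apply: closed_eq_hausdorff; first exact: circle_hausdorff.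
      exact: ptws_eval_continuous.
    by apply: circle_mul_continuous; exact: ptws_eval_continuous.
  rewrite eqEsubset; split => [phi hphi x _ y _|phi hphi x y]; first exact: hphi.
  exact: hphi.
exact/ptws_compact/circle_compact.
Qed.

Lemma hom_hausdorff : hausdorff_space (Hom R).
Proof. exact/hausdorff_set_type/ptws_hausdorff/circle_hausdorff. Qed.

End HomTheory.

(* Signed Stirling numbers of the first kind: the coefficients of the falling
   factorial polynomial X (X - 1) ... (X - k + 1). *)
Definition stirling1 (k j : nat) : int :=
  (\prod_(i < k) ('X - (i%:Z)%:P) : {poly int})`_j.

Definition calH (R : realType) : set {ptws nat -> Hom R} :=
  [set Phi : {ptws nat -> Hom R} |
    (forall x, Phi 0%N x = x) /\
    (forall (k : nat) (x : circle R), (0 < k)%N -> rational_circle x ->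
      Phi k (x ^+ k`!)%g =
        (\prod_(1 <= j < k.+1) iter j (Phi 1%N) (x ^z stirling1 k j))%g)].
Arguments calH R : clear implicits.

Section HSystem.
Variable R : realType.
Implicit Types (Phi : {ptws nat -> Hom R}) (x : circle R).

Let ff (k : nat) (n : int) : int := \prod_(i < k) (n - i%:Z).

Let ffS k n : ff k.+1 n = ff k n * (n - k%:Z).
Proof. by rewrite /ff big_ord_recr. Qed.

Let ffSS k n : ff k.+1 (n + 1) = (k.+1)%:Z * ff k n + ff k.+1 n.
Proof.
have -> : ff k.+1 (n + 1) = (n + 1) * ff k n.
  rewrite /ff big_ord_recl /= subr0; congr (_ * _); apply: eq_bigr => i _.
  by rewrite /bump /= PoszD; ring.
have -> : k.+1%:Z = k%:Z + 1 by rewrite -addn1 PoszD.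
by rewrite ffS; ring.
Qed.

Let stirling_sum k n : (0 < k)%N ->
  \sum_(1 <= j < k.+1) stirling1 k j * n ^+ j = ff k n.
Proof.
move=> k0; rewrite /stirling1; set P := \prod_(i < k) _.
have sP : size P = k.+1 by rewrite size_prod_XsubC /index_enum -enumT size_enum_ord.
have P0 : P`_0 = 0.
  rewrite -horner_coef0 horner_prod; case: k k0 {P sP} => // k _.
  by rewrite big_ord_recl hornerXsubC subr0 mul0r.
transitivity (P.[n]); last first.
  by rewrite horner_prod; apply: eq_bigr => i _; rewrite hornerXsubC.
rewrite horner_coef sP -(big_mkord xpredT (fun j => P`_j * n ^+ j)).
by rewrite [RHS]big_nat_recl// big_add1 P0 mul0r add0r.
Qed.

Let iter_exp (phi : Hom R) x (n m : int) j :
  phi x = x ^z n -> iter j phi (x ^z m) = x ^z (m * n ^+ j).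
Proof.
move=> px; elim: j => [|j IH]; first by rewrite expr0 mulr1.
by rewrite iterS IH homXz px -circle_expzM exprSr; congr circle_expz; ring.
Qed.

Let relation_ff (phi : Hom R) x (n : int) k : (0 < k)%N -> phi x = x ^z n ->
  (\prod_(1 <= j < k.+1) iter j phi (x ^z stirling1 k j))%g = x ^z ff k n.
Proof.
move=> k0 px; rewrite -stirling_sum// circle_expz_sum.
by apply: eq_bigr => j _; exact: iter_exp.
Qed.

Let torsion_exp (phi : Hom R) x : rational_circle x ->
  exists n : int, phi x = x ^z n.
Proof.
move=> /rational_circle_torsion[N N0 xN].
by have [n _ ->] := hom_torsion phi N0 xN; exists n.
Qed.

Let calH_ff Phi x (n : int) k : calH R Phi -> rational_circle x ->
  Phi 1%N x = x ^z n -> Phi k (x ^+ k`!)%g = x ^z ff k n.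
Proof.
case=> P0 Pk xQ px; case: k => [|k]; last by rewrite Pk// (relation_ff _ px).
by rewrite P0 /ff big_ord0.
Qed.

Let calH_of_ff Phi : (forall x, Phi 0%N x = x) ->
  (forall x, rational_circle x -> exists2 n : int, Phi 1%N x = x ^z n &
     forall k, Phi k (x ^+ k`!)%g = x ^z ff k n) -> calH R Phi.
Proof.
move=> P0 Pk; split => // k x k0 xQ.
by have [n px Pkn] := Pk x xQ; rewrite (relation_ff k0 px).
Qed.

Definition hT (Phi : {ptws nat -> Hom R}) : {ptws nat -> Hom R} :=
  fun k => if k is k'.+1 then hom_mul (Phi k') (Phi k) else Phi 0%N.

Fixpoint hTinv (Phi : {ptws nat -> Hom R}) (k : nat) : Hom R :=
  if k is k'.+1 then hom_div (Phi k) (hTinv Phi k') else Phi 0%N.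

Lemma hT_calH Phi : calH R Phi -> calH R (hT Phi).
Proof.
move=> HPhi; have P0 := HPhi.1; apply: calH_of_ff => // x xQ.
have [n px] := torsion_exp (Phi 1%N) xQ; exists (n + 1).
  by rewrite /hT hom_mulE P0 px addrC circle_expzD.
case=> [|k]; first by rewrite /= P0 /ff big_ord0.
rewrite /hT hom_mulE (calH_ff k.+1 HPhi xQ px) factS mulnC circle_expM homX.
by rewrite (calH_ff k HPhi xQ px) ffSS circle_expzD mulrC circle_expzM.
Qed.

Lemma hTinv_calH Phi : calH R Phi -> calH R (hTinv Phi : {ptws nat -> Hom R}).
Proof.
move=> HPhi; have P0 := HPhi.1; apply: calH_of_ff => // x xQ.
have [n px] := torsion_exp (Phi 1%N) xQ; exists (n - 1).
  by apply: cval_inj; rewrite /= hom_divE P0 px circle_expzD.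
elim=> [|k IH]; first by rewrite /= P0 /ff big_ord0.
rewrite [hTinv _ _]/= hom_divE (calH_ff k.+1 HPhi xQ px) factS mulnC circle_expM homX.
rewrite IH -[n in ff _ n](subrK 1) ffSS circle_expzD [_ * ff k _]mulrC.
rewrite circle_expzM; apply: cval_inj; rewrite !cvalM cvalV mulrAC mulfV ?mul1r//.
exact: cval_neq0.
Qed.

Lemma hTK Phi : hTinv (hT Phi) = Phi.
Proof.
apply/funext; elim=> [|k IH] //=; apply: hom_ext => x.
rewrite hom_divE hom_mulE IH; apply: cval_inj.
by rewrite !cvalM cvalV mulrAC mulfV ?mul1r// cval_neq0.
Qed.

Lemma hTinvK Phi : hT (hTinv Phi) = Phi.
Proof.
apply/funext; case=> [|k] //=; apply: hom_ext => x.
rewrite hom_mulE hom_divE; apply: cval_inj.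
by rewrite !cvalM cvalV mulrCA mulfV ?mulr1// cval_neq0.
Qed.

Definition calH_T (Phi : calH R) : calH R :=
  SigSub (mem_set (hT_calH (set_valP Phi))).

Definition calH_Tinv (Phi : calH R) : calH R :=
  SigSub (mem_set (hTinv_calH (set_valP Phi))).

Let seq_eval_continuous k x : continuous (fun Phi => Phi k x).
Proof.
move=> Phi; apply: (@continuous_comp _ _ _ (fun Phi : {ptws nat -> Hom R} => Phi k)
  (fun phi : Hom R => phi x)).
  exact: ptws_eval_continuous.
exact: hom_eval_continuous.
Qed.

Let hT_continuous : continuous hT.
Proof.
apply: ptws_continuousP => k; apply: hom_continuousP => x.
case: k => [|k]; first exact: seq_eval_continuous.
by apply: circle_mul_continuous; exact: seq_eval_continuous.
Qed.

Let hTinv_continuous :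
  continuous (hTinv : {ptws nat -> Hom R} -> {ptws nat -> Hom R}).
Proof.
apply: ptws_continuousP => k; apply: hom_continuousP => x.
elim: k => [|k IH]; first exact: seq_eval_continuous.
apply: circle_mul_continuous; first exact: seq_eval_continuous.
exact: circle_inv_continuous.
Qed.

Let calH_T_continuous : continuous calH_T.
Proof.
apply: set_val_continuousP => Phi /=.
apply: (@continuous_comp _ _ _ set_val hT); first exact: set_val_continuous.
exact: hT_continuous.
Qed.

Let calH_Tinv_continuous : continuous calH_Tinv.
Proof.
apply: set_val_continuousP => Phi /=.
apply: (@continuous_comp _ _ _ set_val
  (hTinv : {ptws nat -> Hom R} -> {ptws nat -> Hom R})).
  exact: set_val_continuous.
exact: hTinv_continuous.
Qed.

Let calH_TK : cancel calH_T calH_Tinv.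
Proof. by move=> Phi; apply: set_val_inj; exact: hTK. Qed.

Let calH_TinvK : cancel calH_Tinv calH_T.
Proof. by move=> Phi; apply: set_val_inj; exact: hTinvK. Qed.

Let calH_compact : compact [set: calH R].
Proof.
apply: compact_set_type.
apply: (@subclosed_compact _ _ [set: {ptws nat -> Hom R}]) => //; last first.
  exact/ptws_compact/hom_compact.
rewrite (_ : calH R =
  (\bigcap_x [set Phi : {ptws nat -> Hom R} | Phi 0%N x = x]) `&`
  (\bigcap_(k in [set k | (0 < k)%N]) \bigcap_(x in @rational_circle R)
    [set Phi : {ptws nat -> Hom R} | Phi k (x ^+ k`!)%g =
      (\prod_(1 <= j < k.+1) iter j (Phi 1%N) (x ^z stirling1 k j))%g])).
  apply: closedI.
    apply: closed_bigI => x _.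
    apply: closed_eq_hausdorff; first exact: circle_hausdorff.
      exact: seq_eval_continuous.
    exact: cst_continuous.
  apply: closed_bigI => k _; apply: closed_bigI => x.
  move=> /rational_circle_torsion[N N0 xN].
  apply: closed_eq_hausdorff; first exact: circle_hausdorff.
    exact: seq_eval_continuous.
  apply: circle_prod_continuous => j Phi.
  apply: (@continuous_comp _ _ _ (fun Phi : {ptws nat -> Hom R} => Phi 1%N)
    (fun phi : Hom R => iter j phi (x ^z stirling1 k j))).
    exact: ptws_eval_continuous.
  apply: (hom_iter_continuous N0).
  change (x ^z stirling1 k j ^z N%:Z = 1%g).
  rewrite -circle_expzM mulrC circle_expzM /= xN.
  by apply: cval_inj; rewrite cvalXz cval1 exp1rz.
rewrite eqEsubset; split => [Phi [h0 hk]|Phi [h0 hk]].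
  by split => [x _|k k0 x xQ]; [exact: h0|exact: hk].
by split => [x|k x k0 xQ]; [exact: h0|exact: hk].
Qed.

Let calH_hausdorff : hausdorff_space (calH R).
Proof. exact/hausdorff_set_type/ptws_hausdorff/hom_hausdorff. Qed.

Definition calH_system : dynSys :=
  DynSys calH_compact calH_hausdorff calH_T_continuous calH_Tinv_continuous
    calH_TK calH_TinvK.

End HSystem.
Arguments calH_system R : clear implicits.

Fixpoint quasi_eigen (R : realType) (X : dynSys) (m : nat) :
    set (X -> circle R) :=
  if m is m'.+1 then
    [set g | continuous g /\
       exists2 f, quasi_eigen m' f & forall x, g (dyn x) = (f x * g x)%g]
  else [set g | exists c, g = cst c].
Arguments quasi_eigen R X m : clear implicits.

Definition quasi_eigens (R : realType) (X : dynSys) : set (X -> circle R) :=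
  \bigcup_m quasi_eigen R X m.
Arguments quasi_eigens R X : clear implicits.

Definition linear_span (K : pzRingType) (V : lmodType K) (A : set V) : set V :=
  [set v | exists (n : nat) (c : 'I_n -> K) (g : 'I_n -> V),
     (forall i, A (g i)) /\ v = \sum_(i < n) c i *: g i].

(* [{uniform X -> Cplx R}] carries the topology of uniform convergence, which on
   continuous functions over a compact space is that of the supremum norm. *)
Definition quasi_discrete_spectrum (R : realType) (X : dynSys) : Prop :=
  [set f : {uniform X -> Cplx R} | continuous (f : X -> Cplx R)] `<=`
  closure (linear_span [set cval \o g | g in quasi_eigens R X]
    : set {uniform X -> Cplx R}).

(* Main.v *)
Require Import Defs.
From HB Require Import structures.
From mathcomp Require Import all_boot all_order all_algebra.
From mathcomp Require Import complex ring lra.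
From mathcomp Require Import all_classical all_reals all_analysis.
Import Defs.

(* Write a point of H as a formal power series Phi(t) = sum_k phi_k t^k over the
   (noncommutative) ring E of endomorphisms of the discrete circle, so that T is
   multiplication by 1 + t. The closure O of the powers (1 + t)^n, n in Z, is a
   closed semigroup of power series with constant term 1; by Ellis' idempotent
   lemma it is a group. It acts on H by multiplication, and this induces a
   continuous homomorphism from O onto the enveloping semigroup of the factor X;
   let K be its kernel, a closed normal subgroup.

   Let m be the least order at which some element of K differs from 1, and let N
   be the closed group of the coefficients k_m, k in K. Normality makes K
   contain commutators, so that the coefficients of order m + 1 of the elements
   of K equal to 1 up to order m include all b k_m - k_m b, where b is any element
   of E because the powers of the identity are dense in E. By Pontryagin duality,
   and since only the integers are central in E, these coefficients include every
   endomorphism killing the roots of unity. The defining relations of H force the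
   coefficients of order > m of an element of O that is 1 up to order m to be of
   this kind, so K contains all such elements. Hence the functions
   Phi |-> phi_j(x) with j < m, and those with j = m and x annihilated by N,
   descend to the enveloping semigroup and separate its points. They are
   quasi-eigenfunctions, and the Stone-Weierstrass theorem concludes. *)

Set Implicit Arguments.
Unset Strict Implicit.
Unset Printing Implicit Defensive.

Import Order.TTheory GRing.Theory Num.Theory.
Import numFieldNormedType.Exports.

Local Open Scope classical_set_scope.
Local Open Scope ring_scope.
Local Open Scope complex_scope.

(** * The Stone-Weierstrass theorem *)

(** Otherwise the complements of the sets satisfying [P] form a proper filter, and a neighbourhood
    satisfying [P] of one of its cluster points gives a contradiction. *)
Lemma compact_set_ind (Y : topologicalType) (P : set Y -> Prop) :
  compact [set: Y] -> P set0 ->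
  (forall U V, U `<=` V -> P V -> P U) ->
  (forall U V, P U -> P V -> P (U `|` V)) ->
  (forall y : Y, exists2 U, nbhs y U & P U) -> P setT.
Proof.
move=> cY P0 Psub PU Ploc; apply: contrapT => nP.
pose F : set_system Y := [set B | P (~` B)].
have FF : ProperFilter F.
  apply: Build_ProperFilter; first by rewrite /F /= setC0.
  split; first by rewrite /F /= setCT.
    by move=> A B; rewrite /F /= setCI; exact: PU.
  by move=> A B AB; apply: Psub; exact: subsetC.
have [y [_ Fy]] := cY F FF filterT.
have [U yU PUU] := Ploc y.
have FU : F (~` U) by rewrite /F /= setCK.
by have [z []] := Fy _ _ FU yU.
Qed.

Section RealStoneWeierstrass.
Variables (R : realType) (Y : topologicalType) (A : set (Y -> R)).
Hypothesis Y_compact : compact [set: Y].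
Hypothesis A_continuous : forall u, A u -> continuous u.
Hypothesis A_cst : forall c, A (cst c).
Hypothesis A_add : forall u v, A u -> A v -> A (fun y => u y + v y).
Hypothesis A_mul : forall u v, A u -> A v -> A (fun y => u y * v y).
Hypothesis A_sep : forall x y, x <> y -> exists2 u, A u & u x <> u y.

Let A_scale c u : A u -> A (fun y => c * u y).
Proof. by move=> Au; exact: (A_mul (A_cst c) Au). Qed.

Let B : set (Y -> R) := [set f | continuous f /\
  forall e : R, 0 < e -> exists2 u, A u & forall y, `|f y - u y| < e].

Let AB u : A u -> B u.
Proof.
move=> Au; split=> [|e e0]; first exact: A_continuous.
by exists u => // y; rewrite subrr normr0.
Qed.

Let B_add u v : B u -> B v -> B (fun y => u y + v y).
Proof.
move=> [cu Bu] [cv Bv]; split=> [y|e e0].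
  exact: (@continuousD R R^o _ u v y (cu y) (cv y)).
have [|u' Au' u'u] := Bu (e / 2); first by lra.
have [|v' Av' v'v] := Bv (e / 2); first by lra.
exists (fun y => u' y + v' y); first exact: A_add.
move=> y; rewrite opprD addrACA (le_lt_trans (ler_normD _ _))//.
by have := u'u y; have := v'v y; lra.
Qed.

Let B_scale c u : B u -> B (fun y => c * u y).
Proof.
move=> [cu Bu]; split=> [y|e e0].
  by apply: (@continuousM R Y (cst c) u y); [exact: cst_continuous|exact: cu].
have [|u' Au' u'u] := Bu (e / (`|c| + 1)); first by apply: divr_gt0 => //; lra.
exists (fun y => c * u' y); first exact: A_scale.
move=> y; rewrite -mulrBr normrM.
have := u'u y; rewrite ltr_pdivlMr; last by have := normr_ge0 c; lra.
by have := normr_ge0 c; have := normr_ge0 (u y - u' y); nra.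
Qed.

(* The recursion p <- p + (v^2 - p^2)/2 increases to |v| uniformly when
   |v| <= 1. *)
Let abs_iter n (t : R) : R := iter n (fun p : R => p + (t ^+ 2 - p ^+ 2) / 2) 0.

Let abs_iter_bound n t : `|t| <= 1 ->
  0 <= abs_iter n t <= `|t| /\ (`|t| - abs_iter n t) * n.+1%:R <= 2.
Proof.
move=> t1; elim: n => [|n [/andP[p0 pt] IH]].
  rewrite /abs_iter /= lexx normr_ge0 subr0; split=> //.
  by rewrite mulr1 (le_trans t1)// ler1n.
have -> : abs_iter n.+1 t = abs_iter n t + (t ^+ 2 - abs_iter n t ^+ 2) / 2 by [].
rewrite -[t ^+ 2]real_normK ?num_real//.
have n0 : 0 <= n%:R :> R by [].
move: p0 pt IH t1 n0; rewrite -(natr1 n.+1) -(natr1 n).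
move: (abs_iter n t) (`|t|) => p a.
move: (n%:R) => m p0 pt IH t1 n0.
have d0 : 0 <= a - p by lra.
have d2 : 0 <= 1 - (a + p) / 2 by lra.
have d3 : 0 <= (a - p) * (1 - (a + p) / 2) by exact: mulr_ge0.
have d4 : 0 <= (a - p) * (a + p) by apply: mulr_ge0; lra.
split; first by apply/andP; split; lra.
have h : (a - (p + (a ^+ 2 - p ^+ 2) / 2)) * (m + 1 + 1) =
  (a - p) * (1 - (a + p) / 2) * (m + 1 + 1) by field.
rewrite h.
(* One iteration multiplies the error [a - p] by [1 - (a + p) / 2]. If [(a - p) * (m + 2)] exceeds
   2, this factor is at most [1 - 1 / (m + 2)], since [a + p >= a - p], and the bound at [m + 1]
   carries over. *)
have [d1|d1] := leP ((a - p) * (m + 1 + 1)) 2.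
  have : 0 <= (a - p) * (a + p) * (m + 1 + 1) by apply: mulr_ge0; lra.
  by lra.
have h1 : 0 <= (a - p) * p * (m + 1 + 1).
  by apply: mulr_ge0; [exact: mulr_ge0|lra].
have h2 : 0 <= ((a - p) * (m + 1 + 1) - 2) * (a - p) by apply: mulr_ge0; lra.
by lra.
Qed.

Let bounded_cont (u : Y -> R) : continuous u -> exists2 M, 0 < M & forall y, `|u y| <= M.
Proof.
move=> cu; suff [M M0 h] : exists2 M, 0 < M & forall y, setT y -> `|u y| <= M.
  by exists M => // y; exact: h.
apply: (@compact_set_ind Y (fun U => exists2 M, 0 < M & forall y, U y -> `|u y| <= M)) => //.
- by exists 1.
- by move=> U V UV [M M0 h]; exists M => // y /UV; exact: h.
- move=> U V [M M0 h] [M' M'0 h']; exists (M + M'); first by lra.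
  by move=> y [/h|/h']; lra.
- move=> y; exists [set z | `|u y - u z| < 1].
    by have /cvgrPdist_lt/(_ 1 ltr01) := cu y.
  exists (`|u y| + 1); first by have := normr_ge0 (u y); lra.
  move=> z /= uz; have := ler_normB (u y) (u y - u z).
  by rewrite opprB addrC subrK; lra.
Unshelve. all: by [].
Qed.

Let A_abs u : A u -> B (fun y => `|u y|).
Proof.
move=> Au; split=> [y|e e0].
  apply: (@continuous_comp _ _ _ u (fun t : R => `|t|)); first exact: A_continuous.
  exact: (@norm_continuous _ R^o).
have [M M0 uM] := bounded_cont (A_continuous Au).
pose v y := M^-1 * u y.
have Av n : A (fun y => abs_iter n (v y)).
  elim: n => [|n IH]; first exact: (A_cst 0).
  have -> : (fun y => abs_iter n.+1 (v y)) = (fun y => abs_iter n (v y) +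
     (2^-1 * (v y * v y) + - 2^-1 * (abs_iter n (v y) * abs_iter n (v y)))).
    by apply/funext => y; rewrite /abs_iter /=; field.
  apply: A_add => //; apply: A_add; apply: A_scale; apply: A_mul => //; exact: A_scale.
pose n := Num.bound (2 * M / e).
have nb : 2 * M / e < n%:R.
  apply: (le_lt_trans (ler_norm _)).
  by have := @archi_boundP R `|2 * M / e| (normr_ge0 _); rewrite /n ger0_norm// divr_ge0//; lra.
exists (fun y => M * abs_iter n (v y)); first exact: A_scale.
move=> y; have v1 : `|v y| <= 1.
  by rewrite /v normrM gtr0_norm ?invr_gt0// mulrC ler_pdivrMr// mul1r.
have [/andP[p0 pt] pn] := abs_iter_bound n v1.
have -> : `|u y| = M * `|v y|.
  by rewrite /v normrM gtr0_norm ?invr_gt0// mulrA mulfV ?mul1r//; exact: lt0r_neq0.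
rewrite -mulrBr normrM gtr0_norm// ger0_norm; last by lra.
rewrite ltr_pdivrMr// in nb.
have n0 : 0 <= n%:R :> R by [].
rewrite -(natr1 n) in pn.
have d0 : 0 <= `|v y| - abs_iter n (v y) by lra.
have h : (M * (`|v y| - abs_iter n (v y))) * (n%:R + 1) <= M * 2 by rewrite -mulrA ler_pM2l.
have h2 : M * 2 < e * (n%:R + 1) by lra.
by have := le_lt_trans h h2; rewrite ltr_pM2r//; lra.
Qed.

Let B_abs u : B u -> B (fun y => `|u y|).
Proof.
move=> [cu Bu]; split=> [y|e e0].
  apply: (@continuous_comp _ _ _ u (fun t : R => `|t|)); first exact: cu.
  exact: (@norm_continuous _ R^o).
have [|v Av uv] := Bu (e / 2); first by lra.
have [_ /(_ (e / 2))] := A_abs Av; case; first by lra.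
move=> w Aw vw; exists w => // y.
have := uv y; have := vw y; have := ler_dist_dist (u y) (v y).
have := ler_normD (`|u y| - `|v y|) (`|v y| - w y).
by rewrite addrA subrK; lra.
Qed.

Let B_min u v : B u -> B v -> B (fun y => Num.min (u y) (v y)).
Proof.
move=> Bu Bv.
have -> : (fun y => Num.min (u y) (v y)) =
    (fun y => 2^-1 * (u y + (v y + (- 1) * `|u y + (- 1) * v y|))).
  apply/funext => y; case: (leP (u y) (v y)) => uv.
    by rewrite ler0_norm; [field|lra].
  by rewrite gtr0_norm; [field|lra].
apply/B_scale/B_add/B_add => //; apply/B_scale/B_abs/B_add => //.
exact: B_scale.
Qed.

Let B_max u v : B u -> B v -> B (fun y => Num.max (u y) (v y)).
Proof.
move=> Bu Bv.
have -> : (fun y => Num.max (u y) (v y)) =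
    (fun y => - 1 * Num.min (- 1 * u y) (- 1 * v y)).
  apply/funext => y; rewrite !mulN1r.
  by case: (leP (u y) (v y)) => uv; case: leP => //; lra.
by apply: B_scale; apply: B_min; exact: B_scale.
Qed.

Let interp (f : Y -> R) x y : exists u, [/\ A u, u x = f x & u y = f y].
Proof.
have [<-|xy] := pselect (x = y); first by exists (cst (f x)); split.
have [u Au uxy] := A_sep xy.
have d0 : u y - u x != 0 by rewrite subr_eq0; apply/eqP => h; apply: uxy.
exists (fun z => f x + (f y - f x) / (u y - u x) * (u z + - u x)); split.
- apply: A_add; first exact: A_cst.
  by apply: A_scale; exact: (A_add Au (A_cst _)).
- by rewrite addrN mulr0 addr0.
- by rewrite divfK// addrC subrK.
Qed.

(** The uniform closure [B] of [A] is a lattice. For each x, a finite minimum of interpolating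
    functions stays below f + e/2 and meets f at x; a finite maximum of such minima is also above f
    - e/2. *)
Lemma real_stone_weierstrass (f : Y -> R) : continuous f ->
  forall e : R, 0 < e -> exists2 u, A u & forall y, `|f y - u y| < e.
Proof.
move=> cf e e0.
have near_lt (u v : Y -> R) y : continuous u -> continuous v -> u y < v y ->
    nbhs y [set z | u z < v z].
  move=> cu cv uv.
  have [e1 e1u e1v] : exists2 m, u y < m & m < v y by exists ((u y + v y) / 2); lra.
  have h1 : nbhs y [set z | u z < e1] by exact: (cu y _ (lt_nbhsl e1u)).
  have h2 : nbhs y [set z | e1 < v z] by exact: (cv y _ (lt_nbhsr e1v)).
  by apply: filterS2 h1 h2 => z /=; exact: lt_trans.
have cfe c : continuous (fun z => f z + c).
  by move=> y; apply: (@continuousD R R^o _ f (cst c) y (cf y)); exact: cst_continuous.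
have below x : exists g, [/\ B g, g x = f x & forall y, g y < f y + e / 2].
  suff [g [Bg gx gy]] : exists g, [/\ B g, g x = f x & forall y, setT y -> g y < f y + e / 2].
    by exists g; split=> // y; exact: gy.
  apply: (@compact_set_ind Y (fun U => exists g,
    [/\ B g, g x = f x & forall y, U y -> g y < f y + e / 2])) => //.
  - by exists (cst (f x)); split=> //; exact: AB.
  - by move=> U V UV [g [Bg gx gV]]; exists g; split=> // y /UV; exact: gV.
  - move=> U V [g [Bg gx gU]] [h [Bh hx hV]].
    exists (fun y => Num.min (g y) (h y)); split; first exact: B_min.
      by rewrite gx hx minxx.
    by move=> y [/gU|/hV] ?; rewrite gt_min; apply/orP; [left|right].
  - move=> y; have [u [Au ux uy]] := interp f x y.
    exists [set z | u z < f z + e / 2]; last by exists u; split=> //; exact: AB.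
    by apply: near_lt => //; [exact: A_continuous|rewrite uy; lra].
suff [g [[_ Bg] g1 g2]] : exists g, [/\ B g, forall y, g y < f y + e / 2 &
    forall y, setT y -> f y + - (e / 2) < g y].
  have [|u Au gu] := Bg (e / 2); first by lra.
  exists u => // y; have := gu y; have := g1 y; have := g2 y Logic.I.
  by rewrite !ltr_norml; lra.
apply: (@compact_set_ind Y (fun U => exists g, [/\ B g, forall y, g y < f y + e / 2 &
    forall y, U y -> f y + - (e / 2) < g y])) => //.
- have [[y]|nY] := pselect (exists y : Y, True).
    by have [g [Bg _ gy]] := below y; exists g; split.
  exists (cst 0); split=> [|y|//]; first exact: AB.
  by exfalso; apply: nY; exists y.
- by move=> U V UV [g [Bg g1 g2]]; exists g; split=> // y /UV; exact: g2.
- move=> U V [g [Bg g1 gU]] [h [Bh h1 hV]].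
  exists (fun y => Num.max (g y) (h y)); split; first exact: B_max.
    by move=> y; rewrite gt_max g1 h1.
  by move=> y [/gU|/hV] ?; rewrite lt_max; apply/orP; [left|right].
- move=> x; have [g [Bg gx g1]] := below x.
  exists [set z | f z + - (e / 2) < g z]; last by exists g; split.
  by apply: near_lt => //; [exact: Bg.1|rewrite gx; lra].
Qed.

End RealStoneWeierstrass.

Section LinearSpan.
Variables (K : pzRingType) (V : lmodType K) (A : set V).

Lemma linear_span_incl v : A v -> linear_span A v.
Proof.
move=> Av; exists 1%N, (fun=> 1), (fun=> v); split=> //.
by rewrite big_ord1 scale1r.
Qed.

Lemma linear_spanD v w : linear_span A v -> linear_span A w -> linear_span A (v + w).
Proof.
move=> [n [c [g [Ag ->]]]] [m [d [h [Ah ->]]]].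
exists (n + m)%N, (fun i => match fintype.split i with inl j => c j | inr j => d j end),
  (fun i => match fintype.split i with inl j => g j | inr j => h j end); split.
  by move=> i; case: fintype.split => j.
rewrite big_split_ord; congr (_ + _); apply: eq_bigr => i _.
  by rewrite (unsplitK (inl i)).
by rewrite (unsplitK (inr i)).
Qed.

Lemma linear_spanZ a v : linear_span A v -> linear_span A (a *: v).
Proof.
move=> [n [c [g [Ag ->]]]]; exists n, (fun i => a * c i), g; split=> //.
by rewrite scaler_sumr; apply: eq_bigr => i _; rewrite scalerA.
Qed.

Lemma linear_span_ind (P : V -> Prop) : P 0 -> (forall v w, P v -> P w -> P (v + w)) ->
  (forall a v, P v -> P (a *: v)) -> (forall v, A v -> P v) ->
  forall v, linear_span A v -> P v.
Proof.
move=> P0 PD PZ PA v [n [c [g [Ag ->]]]].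
by elim/big_ind: _ => // i _; exact/PZ/PA.
Qed.

End LinearSpan.

Section ComplexContinuity.
Variable R : realType.

Lemma Re_continuous : continuous (fun z : Cplx R => complex.Re z : R).
Proof.
 move=> z; have FF : Filter (nbhs (z : Cplx R)) by exact: nbhs_filter.
apply/(@cvgrPdist_lt _ R^o _ (nbhs (z : Cplx R)) FF) => e e0.
have e0' : 0 < e%:C :> Cplx R by rewrite ltcR.
near=> w; rewrite -ltcR -raddfB; apply: le_lt_trans (normc_ge_Re _) _.
by near: w; exact: (@nbhsx_ballx _ (Cplx R)).
Unshelve. all: by end_near. Qed.

(** The imaginary part is written as a real part, so that one argument about real parts serves for
    both. *)
Lemma complex_ReIm (z : R[i]) : z = (complex.Re z)%:C + 'i * (complex.Re (- 'i * z))%:C.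
Proof. by rewrite [LHS]complexE; case: z => a b /=; congr (_ + _ * _%:C); ring. Qed.

End ComplexContinuity.

(** * Stone-Weierstrass for the span of a group of circle-valued functions *)

Section CircleStoneWeierstrass.
Variables (R : realType) (Y : topologicalType) (S : set (Y -> circle R)).
Hypothesis Y_compact : compact [set: Y].
Hypothesis S_continuous : forall g, S g -> continuous g.
Hypothesis S_one : S (fun=> 1%g).
Hypothesis S_mul : forall g h, S g -> S h -> S (fun y => (g y * h y)%g).
Hypothesis S_inv : forall g, S g -> S (fun y => (g y)^-1%g).
Hypothesis S_sep : forall x y, x <> y -> exists2 g, S g & g x <> g y.

Let L : set (Y -> Cplx R) := linear_span [set cval \o g | g in S].

Let L_mul v w : L v -> L w -> L (fun y => v y * w y).
Proof.
move=> + Lw; move: v; apply: linear_span_ind.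
- have -> : (fun y => 0 * w y) = 0 *: w by apply/funext => y.
  exact: linear_spanZ.
- move=> v v' Lv Lv'.
  have -> : (fun y => (v + v') y * w y) = (fun y => v y * w y) + (fun y => v' y * w y).
    by apply/funext => y; exact: mulrDl.
  exact: linear_spanD.
- move=> a v Lv.
  have -> : (fun y => (a *: v) y * w y) = a *: (fun y => v y * w y).
    by apply/funext => y; exact: (esym (mulrA a (v y) (w y))).
  exact: linear_spanZ.
- move=> _ [g Sg <-]; move: w Lw; apply: linear_span_ind.
  + have -> : (fun y => (cval \o g) y * 0) = 0 *: (cval \o g : Y -> Cplx R).
      by apply/funext => y; rewrite !fctE mulr0 scale0r.
    by apply: linear_spanZ; apply: linear_span_incl; exists g.
  + move=> v v' Lv Lv'.
    have -> : (fun y => (cval \o g) y * (v + v') y) =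
        (fun y => cval (g y) * v y) + (fun y => cval (g y) * v' y).
      by apply/funext => y; exact: mulrDr.
    exact: linear_spanD.
  + move=> a v Lv.
    have -> : (fun y => (cval \o g) y * (a *: v) y) = a *: (fun y => cval (g y) * v y).
      by apply/funext => y; exact: (mulrCA (cval (g y) : R[i]) a (v y)).
    exact: linear_spanZ.
  + move=> _ [h Sh <-]; apply: linear_span_incl.
    by exists (fun y => (g y * h y)%g); first exact: S_mul.
Qed.

Let L_continuous v : L v -> continuous v.
Proof.
move: v; apply: linear_span_ind.
- exact: (@cst_continuous Y (Cplx R) 0).
- by move=> v w cv cw y; exact: (@continuousD R[i] (Cplx R) Y v w y (cv y) (cw y)).
- move=> a v cv y; apply: (@continuousM R[i] Y (cst a) v y); first exact: cst_continuous.
  exact: cv.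
- move=> _ [g Sg <-] y; apply: continuous_comp; first exact: S_continuous.
  exact: cval_continuous.
Qed.

Let L_cst (c : R) : L (fun=> c%:C).
Proof.
have -> : (fun=> c%:C) = (c%:C : R[i]) *: (cval \o (fun=> 1%g) : Y -> Cplx R).
  by apply/funext => y; exact: (esym (mulr1 (c%:C : R[i]))).
by apply: linear_spanZ; apply: linear_span_incl; exists (fun=> 1%g).
Qed.

Let A : set (Y -> R) := [set u | L (fun y => (u y)%:C)].

(** On the circle conjugation is inversion, so Re(a g) is half the sum of a g and conj(a) g^-1. *)
Let A_Re (a : R[i]) g : S g -> A (fun y => complex.Re (a * cval (g y))).
Proof.
move=> Sg; rewrite /A /=.
have -> : (fun y => (complex.Re (a * cval (g y)))%:C) =
    (a / 2) *: (cval \o g : Y -> Cplx R) + (conjc a / 2) *: (cval \o (fun y => (g y)^-1%g)).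
  apply/funext => y.
  change ((complex.Re (a * cval (g y)))%:C = a / 2 * cval (g y) + a^* / 2 * (cval (g y))^-1).
  have h : (cval (g y))^-1 = conjc (cval (g y)) :> R[i].
    by rewrite invc_norm cval_norm expr1n invr1 mul1r.
  by rewrite h ReJ_add rmorphM /= mulrDl ![_ / 2 * _]mulrAC.
apply: linear_spanD; apply: linear_spanZ; apply: linear_span_incl; first by exists g.
by exists (fun y => (g y)^-1%g) => //; exact: S_inv.
Qed.

Lemma circle_stone_weierstrass (f : Y -> Cplx R) : continuous f ->
  forall e : R, 0 < e -> exists2 v, linear_span [set cval \o g | g in S] v &
    forall y, `|f y - v y| <= e%:C.
Proof.
move=> cf e e0.
have approx (u : Y -> R) : continuous u -> exists2 v, A v & forall y, `|u y - v y| < e / 2.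
  move=> cu; apply: (@real_stone_weierstrass R Y A) => //.
  - move=> v Av y; apply: (@continuous_comp _ _ _ (fun y => (v y)%:C : Cplx R)
      (fun z => complex.Re z)).
      exact: L_continuous.
    exact: Re_continuous.
  - move=> v w Av Aw; rewrite /A /=.
    have -> : (fun y => (v y + w y)%:C) = (fun y => (v y)%:C) + (fun y => (w y)%:C : Cplx R).
      by apply/funext => y; rewrite !fctE rmorphD.
    exact: linear_spanD.
  - move=> v w Av Aw; rewrite /A /=.
    have -> : (fun y => (v y * w y)%:C) = (fun y => (v y)%:C * (w y)%:C).
      by apply/funext => y; rewrite rmorphM.
    exact: L_mul.
  - move=> x y /S_sep[g Sg gxy].
    have [h|h] := pselect (complex.Re (1 * cval (g x)) = complex.Re (1 * cval (g y))).
      exists (fun y => complex.Re (- 'i * cval (g y))); first exact: A_Re.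
      move=> h'; apply: gxy; apply: cval_inj.
      rewrite !mul1r in h.
      by rewrite [LHS]complex_ReIm [RHS]complex_ReIm h h'.
    by exists (fun y => complex.Re (1 * cval (g y))) => //; exact: A_Re.
  - by lra.
have [|u Lu fu] := approx (fun y => complex.Re (f y)).
  move=> y; apply: (@continuous_comp _ _ _ f (fun z => complex.Re z)); first exact: cf.
  exact: Re_continuous.
have [|v Lv fv] := approx (fun y => complex.Re (- 'i * f y)).
  move=> y; apply: (@continuous_comp _ _ _ (fun y => - 'i * f y : Cplx R)
    (fun z => complex.Re z)); last exact: Re_continuous.
  apply: (@continuousM R[i] Y (cst (- 'i)) f y); first exact: cst_continuous.
  exact: cf.
exists ((fun y => (u y)%:C : Cplx R) + ('i : R[i]) *: (fun y => (v y)%:C : Cplx R)).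
  by apply: linear_spanD => //; exact: linear_spanZ.
move=> y; rewrite [f y in X in X <= _]complex_ReIm !fctE.
have -> : forall a b c d : R, (a%:C + 'i * b%:C) - (c%:C + 'i * d%:C) =
    (a - c)%:C + 'i * (b - d)%:C :> R[i].
  by move=> a b c d; rewrite !rmorphB /=; ring.
apply: (le_trans (ler_normD _ _)); rewrite normrM normCi mul1r.
have nC (a : R) : `|a%:C| = `|a|%:C :> R[i] by rewrite normc_def /= expr0n addr0 sqrtr_sqr.
rewrite !nC -rmorphD /= lecR; apply: ltW.
have := fu y; have := fv y => /=; lra.
Qed.

End CircleStoneWeierstrass.

(** * Duality for the endomorphisms of the circle *)

Section ComplexModulus.
Variable R : realType.

Lemma norm_real_complex (a : R) : `|a%:C| = `|a|%:C :> R[i].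
Proof. by rewrite normc_def /= expr0n addr0 sqrtr_sqr. Qed.

Lemma norm_Re_complex (z : R[i]) : `|z| = (complex.Re `|z|)%:C.
Proof. by rewrite normc_def. Qed.

(** The sum times w - 1 is w^M - 1, of modulus at most 2; any M > 2 / (d |w - 1|) will do. *)
Lemma norm_geom_sum_bound (w : R[i]) (d : R) : `|w| = 1 -> w != 1 -> 0 < d ->
  exists2 M, (0 < M)%N & `|\sum_(l < M) w ^+ l| <= (d * M%:R)%:C.
Proof.
move=> w1 wn1 d0; have wn1' : w - 1 != 0 by rewrite subr_eq0.
set a := complex.Re `|w - 1|.
have a0 : 0 < a by rewrite -ltcR -norm_Re_complex normr_gt0.
pose M := (Num.bound (2 / (d * a))).+1; exists M => //.
have Mb : 2 / (d * a) < M%:R.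
  have h : 0 <= 2 / (d * a) by apply: divr_ge0 => //; exact/ltW/mulr_gt0.
  apply: lt_trans (archi_boundP h) _.
  by rewrite ltr_nat.
have nw : `|w - 1| * `|\sum_(l < M) w ^+ l| <= 2.
  rewrite -normrM -subrX1 (le_trans (ler_normB _ _))// normrX w1 expr1n normr1.
  by rewrite -[1 + 1]/(2%:R : R[i]).
rewrite norm_Re_complex [X in _ * X <= _]norm_Re_complex -/a -rmorphM /= in nw.
rewrite norm_Re_complex lecR.
have {}nw : a * complex.Re `|\sum_(l < M) w ^+ l| <= 2.
  by rewrite -lecR; move: nw; rewrite (_ : (2 : R)%:C = 2 :> R[i])// rmorph_nat.
rewrite ltr_pdivrMr in Mb; last exact: mulr_gt0.
rewrite -(ler_pM2l a0) (le_trans nw)//; apply: ltW; apply: (lt_le_trans Mb).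
by rewrite mulrCA mulrA mulrC !mulrA mulrC mulrA.
Qed.

End ComplexModulus.

(** * Closed subgroups of [Hom R] and their annihilators *)

Section Annihilator.
Variable R : realType.
Implicit Types (phi psi b : Hom R) (x : circle R).

Definition hom_one : Hom R := @mk_hom R (fun=> 1%g) (fun _ _ => esym (mulg1 _)).

Variable N : set (Hom R).
Hypothesis N_closed : closed N.
Hypothesis N_one : N hom_one.
Hypothesis N_div : forall phi psi, N phi -> N psi -> N (hom_div phi psi).

Let N_mul phi psi : N phi -> N psi -> N (hom_mul phi psi).
Proof.
move=> Nphi Npsi; have := N_div Nphi (N_div N_one Npsi); congr N.
by apply: hom_ext => x; rewrite hom_mulE !hom_divE mul1g invgK.
Qed.

(* Averaging a power sequence of an element of N moving x x_i kills the
   character x_i of Hom R. *)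
Let killing_average (n : nat) (x : 'I_n -> circle R) (d : R) (s : seq 'I_n) : 0 < d ->
  exists (J : finType) (t : J -> Hom R), [/\ (0 < #|J|)%N, forall j, N (t j) &
    forall i, i \in s -> (exists2 psi, N psi & psi (x i) <> 1%g) ->
      `|\sum_j (cval (t j (x i)) : R[i])| <= (d * #|J|%:R)%:C].
Proof.
move=> d0; elim: s => [|i s [J [t [J0 Nt ts]]]].
  by exists unit, (fun=> hom_one); rewrite card_unit; split.
have [[eta Neta etax]|nb] := pselect (exists2 psi, N psi & psi (x i) <> 1%g); last first.
  exists J, t; split=> // k; rewrite inE => /predU1P[-> /nb//|]; exact: ts.
have x1 : (cval (eta (x i)) : R[i]) != 1.
  by apply/eqP => h; apply: etax; exact: cval_inj.
have [M M0 Mb] := norm_geom_sum_bound (cval_norm (eta (x i))) x1 d0.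
pose pw l := iter l (hom_mul eta) hom_one.
have Npw l : N (pw l) by elim: l => //= l; exact: N_mul.
have pwE l y : cval (pw l y) = (cval (eta y) : R[i]) ^+ l.
  by elim: l => //= l IH; rewrite hom_mulE cvalM IH exprS.
exists (J * 'I_M)%type, (fun p : J * 'I_M => hom_mul (t p.1) (pw p.2)).
rewrite card_prod card_ord muln_gt0 J0 M0; split=> // [p|k ks kb].
  exact: N_mul.
(* The new family consists of the products of the t_j and the powers of eta, so its character sum
   factors. For k = i the geometric factor is small, for the other k the old factor is; the
   remaining factor is bounded by its number of terms. *)
have -> : \sum_(p : J * 'I_M) (cval (hom_mul (t p.1) (pw p.2) (x k)) : R[i]) =
    (\sum_j (cval (t j (x k)) : R[i])) * (\sum_(l < M) (cval (eta (x k)) : R[i]) ^+ l).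
  rewrite -(pair_bigA _ (fun j (l : 'I_M) => cval (hom_mul (t j) (pw l) (x k)) : R[i])) /=.
  rewrite mulr_suml; apply: eq_bigr => j _; rewrite mulr_sumr; apply: eq_bigr => l _.
  by rewrite hom_mulE cvalM pwE.
have triv (I : finType) (f : I -> R[i]) : (forall a, `|f a| = 1) ->
    `|\sum_a f a| <= (#|I|%:R : R)%:C.
  move=> f1; apply: (le_trans (ler_norm_sum _ _ _)).
  by rewrite (eq_bigr (fun=> 1)) ?sumr_const ?rmorph_nat.
rewrite normrM natrM.
have [ki|ki] := eqVneq k i.
  rewrite ki (_ : d * _ = #|J|%:R * (d * M%:R)) ?rmorphM /=; last by ring.
  apply: ler_pM => //; last by move: Mb; rewrite rmorphM.
  by apply: triv => a; exact: cval_norm.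
rewrite mulrA rmorphM /=; apply: ler_pM => //.
  by apply: ts => //; move: ks; rewrite inE (negbTE ki).
rewrite -[X in X%:R](card_ord M); apply: triv => a.
by rewrite normrX cval_norm expr1n.
Qed.

(** If b is not in [N], a Urysohn function f is 0 on [N] and 1 on the coset of b. Approximate f
    within 1/4 by a combination v of evaluations, and average over a family t_j in [N] on which
    every evaluation nontrivial on [N] nearly cancels. The other evaluations agree at t_j and b t_j.
    So the averages of v over the t_j and over the b t_j differ by at most 1/4, whereas those of f
    differ by 1. *)
Lemma hom_double_annihilator b :
  (forall x, (forall psi, N psi -> psi x = 1%g) -> b x = 1%g) -> N b.
Proof.
move=> bN; apply: contrapT => nNb.
pose N' := [set phi | N (hom_div phi b)].
have N'closed : closed N'.
  apply: (@closed_comp _ _ (fun phi : Hom R => hom_div phi b)) => //.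
  move=> phi _; apply: hom_continuousP => x.
  apply: circle_mul_continuous; first exact: hom_eval_continuous.
  exact: cst_continuous.
have disj : N `&` N' = set0.
  rewrite -subset0 => phi [Nphi Nphib]; apply: nNb.
  have := N_div Nphi Nphib; congr N; apply: hom_ext => x; apply: cval_inj.
  rewrite !hom_divE !cvalM !cvalV !cvalM !cvalV invfM invrK mulrA mulfV ?mul1r//.
  exact: cval_neq0.
have nH := compact_normal (@hom_hausdorff R) (@hom_compact R).
have [f [cf f0 f1 _]] := @urysohn_ext_itv _ R nH _ _ 0 1 N_closed N'closed disj ltr01.
pose S : set (Hom R -> circle R) := [set g | exists x, g = fun phi => phi x].
have cfC : continuous (fun phi : Hom R => (f phi)%:C : Cplx R).
  move=> phi; apply: (@continuous_comp _ _ _ f (fun a : R => a%:C : Cplx R)); first exact: cf.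
  exact: real_complex_continuous.
have [||||||v [n [c [g [Sg vE]]]] fv] :=
  @circle_stone_weierstrass R (Hom R) S (@hom_compact R) _ _ _ _ _ _ cfC (1 / 4).
- by move=> _ [x ->]; exact: hom_eval_continuous.
- by exists 1%g; apply/funext => phi; rewrite hom1.
- by move=> _ _ [x ->] [y ->]; exists (x * y)%g; apply/funext => phi; rewrite homM.
- by move=> _ [x ->]; exists (x^-1)%g; apply/funext => phi; rewrite homV.
- move=> phi psi ne; apply: contrapT => h; apply: ne; apply: hom_ext => x.
  by apply: contrapT => ne; apply: h; exists (fun phi => phi x) => //; exists x.
- by lra.
have [x xE] : exists x : 'I_n -> circle R, forall i, g i = cval \o (fun phi : Hom R => phi (x i)).
  have /choice[x xE] : forall i, exists x, g i = cval \o (fun phi : Hom R => phi x).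
    by move=> i; have [_ [x ->] <-] := Sg i; exists x.
  by exists x.
have vE' phi : v phi = \sum_i c i * (cval (phi (x i)) : R[i]).
  by rewrite vE fct_sumE; apply: eq_bigr => i _; rewrite xE.
pose C := \sum_i complex.Re `|c i|.
have C0 : 0 <= C.
  by apply: sumr_ge0 => i _; rewrite -lecR -norm_Re_complex normr_ge0.
(* This choice makes the third error [2 * d * C] at most 1/4, so that the three errors add up to
   less than 1. *)
pose d := (8 * (C + 1))^-1.
have d0 : 0 < d by rewrite invr_gt0; lra.
have [J [t [J0 Nt tb]]] := killing_average x (enum 'I_n) d0.
set m : R := #|J|%:R; have m0 : 0 < m by rewrite ltr0n.
have sumc (f' : J -> R[i]) (r : R) : (forall j, `|f' j| <= r%:C) -> `|\sum_j f' j| <= (r * m)%:C.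
  move=> h; apply: (le_trans (ler_norm_sum _ _ _)).
  apply: (le_trans (ler_sum _ (fun j _ => h j))).
  by rewrite sumr_const -rmorphMn /= mulr_natr.
have e1 := sumc (fun j => (f (hom_mul b (t j)))%:C - v (hom_mul b (t j))) (1 / 4) (fun j => fv _).
have e2 := sumc (fun j => (f (t j))%:C - v (t j)) (1 / 4) (fun j => fv _).
have e3 : `|\sum_j (v (hom_mul b (t j)) - v (t j))| <= (2 * d * C * m)%:C.
  have -> : \sum_j (v (hom_mul b (t j)) - v (t j)) =
      \sum_i c i * ((cval (b (x i)) : R[i]) - 1) * \sum_j (cval (t j (x i)) : R[i]).
    under eq_bigr do rewrite !vE' -sumrB.
    rewrite exchange_big; apply: eq_bigr => i _; rewrite mulr_sumr; apply: eq_bigr => j _.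
    by rewrite hom_mulE cvalM; ring.
  apply: (le_trans (ler_norm_sum _ _ _)).
  rewrite (_ : 2 * d * C * m = \sum_i complex.Re `|c i| * 2 * (d * m)); last first.
    by rewrite -!mulr_suml -/C; ring.
  rewrite rmorph_sum; apply: ler_sum => i _.
  rewrite !normrM [X in X * _ * _]norm_Re_complex.
  have [h|h] := pselect (exists2 psi, N psi & psi (x i) <> 1%g).
    rewrite 2!rmorphM /= !rmorph_nat; apply: ler_pM => //.
    - by apply: mulr_ge0 => //; rewrite -norm_Re_complex.
    - apply: ler_wpM2l; first by rewrite -norm_Re_complex.
      by rewrite (le_trans (ler_normB _ _))// cval_norm normr1.
    - by apply: tb => //; rewrite mem_enum.
  rewrite bN ?cval1 ?subrr ?normr0 ?mulr0 ?mul0r; last first.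
    by move=> psi Npsi; apply: contrapT => ne; apply: h; exists psi.
  rewrite -[0]/(0%:C) lecR; apply: mulr_ge0; last by apply: mulr_ge0; apply: ltW.
  by apply: mulr_ge0 => //; rewrite -lecR -norm_Re_complex normr_ge0.
have key : (m%:C : R[i]) = \sum_j ((f (hom_mul b (t j)))%:C - v (hom_mul b (t j))) -
    \sum_j ((f (t j))%:C - v (t j)) + \sum_j (v (hom_mul b (t j)) - v (t j)).
  rewrite -sumrB -big_split /= (eq_bigr (fun=> 1)); first by rewrite sumr_const rmorph_nat.
  move=> j _; have -> : f (t j) = 0 by apply: f0; exists (t j).
  have -> : f (hom_mul b (t j)) = 1.
    apply: f1; exists (hom_mul b (t j)) => //; rewrite /N' /=.
    have := Nt j; congr N; apply: hom_ext => y; apply: cval_inj.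
    by rewrite hom_divE hom_mulE !cvalM cvalV mulrAC mulfV ?mul1r// cval_neq0.
  by rewrite rmorph0 rmorph1; ring.
have : `|m%:C : R[i]| <= (1 / 4 * m)%:C + (1 / 4 * m)%:C + (2 * d * C * m)%:C.
  rewrite [in X in X <= _]key (le_trans (ler_normD _ _))//; apply: lerD => //.
  by rewrite (le_trans (ler_normB _ _))//; apply: lerD.
rewrite norm_real_complex ger0_norm ?(ltW m0)// -!rmorphD lecR.
have dC : 8 * (d * C) <= 1.
  have := mulVf (lt0r_neq0 (_ : 0 < 8 * (C + 1))); rewrite -/d => h.
  by have := h ltac:(lra); lra.
have := ler_wpM2r (ltW m0) dC.
by lra.
Qed.

End Annihilator.

(** * Roots and roots of unity in the circle *)

Section RootsOfUnity.
Variable R : realType.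
Implicit Types x y z : circle R.

Lemma norm_expi (t : R) : `|expi t : R[i]| = 1.
Proof. by rewrite normc_def /= cos2Dsin2 sqrtr1. Qed.

Definition circle_expi (t : R) : circle R := mk_circle (norm_expi t).

Lemma circle_root x n : (0 < n)%N -> exists y, (y ^+ n)%g = x.
Proof.
move=> n0; have h : `|n.-root (cval x : R[i])| = 1.
  by rewrite norm_rootC cval_norm rootC1.
exists (mk_circle h); apply: cval_inj; rewrite cvalX; exact: rootCK.
Qed.

(** The angle is 2t with 0 < t < pi, and e^(2it) = 1 would force sin t = 0. *)
Lemma expi_neq1 (n j : nat) : (0 < j < n)%N -> expi (2 * pi * (j%:R / n%:R) : R) != 1.
Proof.
move=> /andP[j0 jn].
have n0' : (0 < n)%N by exact: leq_ltn_trans jn.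
have n0 : (0 : R) < n%:R by rewrite ltr0n.
set t : R := pi * (j%:R / n%:R).
have -> : 2 * pi * (j%:R / n%:R) = t + t by rewrite /t; ring.
have st : 0 < sin t.
  apply: sin_gt0_pi; rewrite mulr_gt0 ?pi_gt0 ?divr_gt0 ?ltr0n//=.
  by rewrite gtr_pMr ?pi_gt0// ltr_pdivrMr// mul1r ltr_nat.
rewrite expiD -expr2 sqrf_eq1 /expi !eq_complex /=.
by rewrite oppr0 (gt_eqF st) !andbF.
Qed.

Lemma expi_root (n : nat) (q : R) : (0 < n)%N ->
  expi (2 * pi * (q / n%:R)) ^+ n = expi (2 * pi * q) :> R[i].
Proof.
move=> n0; rewrite -expiMn -[X in expi X = _]mulr_natr -mulrA divfK//.
by rewrite pnatr_eq0 -lt0n.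
Qed.

Lemma torsion_rational_circle x n : (0 < n)%N -> (x ^+ n)%g = 1%g -> rational_circle x.
Proof.
move=> n0 xn.
have ratE k : ratr (k%:R / n%:R) = k%:R / n%:R :> R.
  by rewrite fmorph_div !rmorph_nat.
pose w : R[i] := expi (2 * pi * (1 / n%:R)).
have wE k : w ^+ k = expi (2 * pi * (k%:R / n%:R)).
  by rewrite /w -expiMn -[X in expi X = _]mulr_natr; congr expi; ring.
have w_prim : n.-primitive_root w.
  rewrite /primitive_root_of_unity n0 /=; apply/forallP => i; rewrite unity_rootE wE.
  have [->|ne] := eqVneq i.+1 n.
    by rewrite divff ?pnatr_eq0 -?lt0n// (@expi2pi_int R 1) eqxx.
  rewrite (negbTE (expi_neq1 _))//= ltn_neqAle ne; exact: ltn_ord.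
have [i xi] : exists i : 'I_n, (cval x : R[i]) = w ^+ i.
  by have [|i ->] := prim_rootP w_prim (_ : (cval x : R[i]) ^+ n = 1); [rewrite -cvalX xn|exists i].
by exists (i%:R / n%:R); rewrite xi wE ratE.
Qed.

Lemma rational_circle_root x n : (0 < n)%N -> rational_circle x ->
  exists2 y, rational_circle y & (y ^+ n)%g = x.
Proof.
move=> n0 [q xq]; exists (circle_expi (2 * pi * ratr (q / n%:R))).
  by exists (q / n%:R).
by apply: cval_inj; rewrite cvalX xq fmorph_div rmorph_nat; exact: expi_root.
Qed.

Lemma circle_unity_root (d : nat) : (1 < d)%N ->
  exists2 y : circle R, (y ^+ d)%g = 1%g & y <> 1%g.
Proof.
move=> d1; exists (circle_expi (2 * pi * (1 / d%:R))).
  apply: cval_inj; rewrite cvalX; rewrite [LHS]expi_root ?(ltnW d1)//.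
  exact: (@expi2pi_int R 1).
by move=> /(congr1 cval)/eqP; apply/negP/(@expi_neq1 d 1).
Qed.

Lemma circle_minus_one : exists y : circle R, y <> 1%g /\ (y * y)%g = 1%g.
Proof.
by have [y y2 y1] := @circle_unity_root 2 isT; exists y.
Qed.

Lemma circle_expz0 x : x ^z 0 = 1%g. Proof. by []. Qed.
Lemma circle_expz1 x : x ^z 1 = x. Proof. by apply: cval_inj; rewrite cvalXz expr1z. Qed.
Lemma circle_expzB x (m n : int) : x ^z (m - n) = (x ^z m * (x ^z n)^-1)%g.
Proof. by apply: cval_inj; rewrite cvalM cvalV !cvalXz expfzDr ?cval_neq0// invr_expz. Qed.
Lemma circle_1expz (n : int) : (1%g : circle R) ^z n = 1%g.
Proof. by apply: cval_inj; rewrite cvalXz cval1 exp1rz. Qed.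

End RootsOfUnity.

(** * Extension of homomorphisms from subgroups of the circle *)

Section HomExtension.
Variable R : realType.
Implicit Types x y z : circle R.

Definition circle_subgroup (S : set (circle R)) :=
  S 1%g /\ forall x y, S x -> S y -> S (x * y^-1)%g.

Lemma subgroup_mul S x y : circle_subgroup S -> S x -> S y -> S (x * y)%g.
Proof.
by move=> [S1 Sd] Sx Sy; have := Sd _ _ Sx (Sd _ _ S1 Sy); rewrite mul1g invgK.
Qed.

Lemma subgroup_expz S x (n : int) : circle_subgroup S -> S x -> S (x ^z n).
Proof.
move=> gS Sx; have Sn k : S (x ^+ k)%g.
  by elim: k => [|k IH]; [exact: gS.1|rewrite expgS; exact: subgroup_mul].
by case: n => n //=; rewrite -[X in S X]mul1g; apply: gS.2 => //; exact: gS.1.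
Qed.

(** The exponents n with z^n in S form a subgroup of the integers: it is 0, or generated by its
    least positive element d. *)
Lemma subgroup_exponents S z : circle_subgroup S ->
  (forall n : int, S (z ^z n) -> n = 0) \/
  exists2 d, (0 < d)%N & S (z ^+ d)%g /\ forall n : int, S (z ^z n) -> exists k : int, n = d%:Z * k.
Proof.
move=> gS; have [ex|nex] := pselect (exists d, `[< (0 < d)%N /\ S (z ^+ d)%g >]).
  right; case: (ex_minnP ex) => d /asboolP[d0 Sd] dmin; exists d => //; split=> // n Sn.
  have d0' : d%:Z != 0 by rewrite eqz_nat -lt0n.
  exists (n %/ d%:Z)%Z; rewrite mulrC {1}(divz_eq n d%:Z).
  have Sr : S (z ^z (n %% d%:Z)%Z).
    rewrite (_ : (n %% d%:Z)%Z = n - d%:Z * (n %/ d%:Z)%Z); last first.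
      by rewrite {2}(divz_eq n d%:Z) mulrC addrAC subrr add0r.
    rewrite circle_expzB; apply: gS.2 => //; rewrite circle_expzM; exact: subgroup_expz.
  have := modz_ge0 n d0'; have := ltz_pmod n (_ : 0 < d%:Z).
  case: (n %% d%:Z)%Z Sr => // r Sr /(_ d0) rd _.
  have [->|r0] := posnP r; first by rewrite addr0.
  have : (d <= r)%N by apply: dmin; apply/asboolP.
  by rewrite leqNgt -ltz_nat rd.
left=> n Sn; apply/eqP; apply: contrapT => /negP n0; apply: nex; exists `|n|%N.
apply/asboolP; split; first by rewrite absz_gt0.
case: n Sn n0 => n Sn n0 //=.
by have := gS.2 _ _ gS.1 Sn; rewrite mul1g /= invgK.
Qed.

(* Graphs of homomorphisms from a subgroup of the circle to the circle. *)
Let hom_graph (G : set (circle R * circle R)) := [/\ G (1%g, 1%g),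
  (forall a c b d, G (a, c) -> G (b, d) -> G (a * b^-1, c * d^-1)%g) &
  forall c, G (1%g, c) -> c = 1%g].

(** The graph of the extension that sends z to v, defined on the subgroup generated by the old
    domain and z. *)
Let adjoin G z v : set (circle R * circle R) :=
  [set p | exists a c (n : int), G (a, c) /\ p = (a * z ^z n, c * v ^z n)%g].

Let adjoin_graph G z v : hom_graph G ->
  (forall (n : int) c, G (z ^z n, c) -> c = v ^z n) ->
  [/\ hom_graph (adjoin G z v), G `<=` adjoin G z v & adjoin G z v (z, v)].
Proof.
move=> [G1 Gd G1c] Gz; split; first split.
- by exists 1%g, 1%g, 0; split=> //; rewrite !circle_expz0 !mulg1.
- move=> a c b d [a' [c' [n [G' [-> ->]]]]] [b' [d' [m [G'' [-> ->]]]]].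
  exists (a' * b'^-1)%g, (c' * d'^-1)%g, (n - m); split; first exact: Gd.
  congr pair; rewrite circle_expzB; apply: cval_inj; rewrite !(cvalM, cvalV) !invfM; ring.
- move=> c [a [c' [n [G' [aE ->]]]]].
  have := Gd _ _ _ _ G1 G'; rewrite !mul1g.
  have -> : (a^-1 = z ^z n)%g.
    by apply: (mulgI a); rewrite mulgV; exact: cval_inj.
  by move=> /Gz <-; rewrite mulgV.
- by move=> [a c] Gac; exists a, c, 0; split=> //; rewrite !circle_expz0 !mulg1.
- by exists 1%g, 1%g, 1; split=> //; rewrite !circle_expz1 !mul1g.
Qed.

(** Divisibility of the circle: if the powers of z in the domain are those with exponent divisible
    by d, any d-th root of the value at z^d serves as v. *)
Let graph_step G z : hom_graph G ->
  exists v, forall (n : int) c, G (z ^z n, c) -> c = v ^z n.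
Proof.
move=> [G1 Gd G1c]; pose D : set (circle R) := [set a | exists c, G (a, c)].
have gD : circle_subgroup D.
  split; first by exists 1%g.
  by move=> x y [c Gc] [d Gd']; exists (c * d^-1)%g; exact: Gd.
have inj a c d : G (a, c) -> G (a, d) -> c = d.
  move=> Gc Gd'; have := Gd _ _ _ _ Gc Gd'; rewrite mulgV => /G1c h.
  by rewrite -[c]mulg1 -(mulVg d) mulgA h mul1g.
have [h|[d d0 [[w Gw] dv]]] := subgroup_exponents z gD.
  exists 1%g => n c Gc; have n0 : n = 0 by apply: h; exists c.
  by rewrite circle_1expz; apply: G1c; rewrite n0 in Gc.
have [v vd] := circle_root w d0; exists v => n c Gc.
have [k nk] := dv n (ex_intro _ c Gc).
apply: (inj _ _ _ Gc); rewrite nk !circle_expzM.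
have -> : v ^z d%:Z = w by [].
have GM a b a' b' : G (a, b) -> G (a', b') -> G (a * a', b * b')%g.
  by move=> h h'; have := Gd _ _ _ _ h (Gd _ _ _ _ G1 h'); rewrite !mul1g !invgK.
have GX j : G ((z ^+ d) ^+ j, w ^+ j)%g.
  by elim: j => // j IH; rewrite !expgS; exact: GM.
by case: k {nk} => k //=; have := Gd _ _ _ _ G1 (GX k.+1); rewrite !mul1g.
Qed.

(** First z is sent to y over the trivial map on S; a maximal graph containing the result is total
    by [graph_step]. *)
Lemma hom_extension (S : set (circle R)) z y : circle_subgroup S ->
  (forall n : int, S (z ^z n) -> y ^z n = 1%g) ->
  exists b : Hom R, (forall x, S x -> b x = 1%g) /\ b z = y.
Proof.
move=> [S1 Sd] Szy; pose GS : set (circle R * circle R) := [set p | S p.1 /\ p.2 = 1%g].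
have gGS : hom_graph GS.
  split; [by []| |by move=> c []].
  by move=> a c b d [/= Sa ->] [/= Sb ->]; split; [exact: Sd|rewrite mulgV].
have [gG0 GS0 G0zy] : [/\ hom_graph (adjoin GS z y), GS `<=` adjoin GS z y & adjoin GS z y (z, y)].
  by apply: adjoin_graph => // n c [/= /Szy -> ->].
set G0 := adjoin GS z y in gG0 GS0 G0zy.
(* Zorn's lemma is applied to the sets whose union with [G0] is a graph, so that the empty chain has
   an admissible union. *)
have [|A [gA Amax]] := @Zorn_bigcup _ [set A | hom_graph (G0 `|` A)].
  move=> F FP Ftot.
  have both p q : (G0 `|` \bigcup_(X in F) X) p -> (G0 `|` \bigcup_(X in F) X) q ->
      exists X, [/\ X `<=` G0 `|` \bigcup_(X in F) X, hom_graph X, X p & X q].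
    have sub X : F X -> G0 `|` X `<=` G0 `|` \bigcup_(X in F) X.
      by move=> FX t [|Xt]; [left|right; exists X].
    move=> [G0p|[X FX Xp]] [G0q|[X' FX' X'q]].
    - by exists G0; split=> // t; left.
    - by exists (G0 `|` X'); split; [exact: sub|exact: FP|left|right].
    - by exists (G0 `|` X); split; [exact: sub|exact: FP|right|left].
    - case: (Ftot _ _ FX FX') => XX'.
        by exists (G0 `|` X'); split; [exact: sub|exact: FP|right; exact: XX'|right].
      by exists (G0 `|` X); split; [exact: sub|exact: FP|right|right; exact: XX'].
  split.
  - by left; case: gG0.
  - by move=> a c b d h h'; have [X [XU [_ Xd _] Xp Xq]] := both _ _ h h'; apply: XU; exact: Xd.
  - by move=> c h; have [X [XU [_ _ X1] Xp Xq]] := both _ _ h h; exact: X1.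
set M := G0 `|` A in gA.
have total x : exists c, M (x, c).
  have [v Mv] := graph_step x gA.
  have [gM' MM' M'x] := adjoin_graph gA Mv.
  apply: contrapT => nx; apply: (Amax (adjoin M x v)).
    split; first by move=> t At; apply: MM'; right.
    by move=> M'A; apply: nx; exists v; right; exact: M'A.
  suff h : G0 `|` adjoin M x v = adjoin M x v by rewrite /= h.
  by apply/setUidPr => t G0t; apply: MM'; left.
have /choice[b bM] := total.
have [M1 Md M1c] := gA.
have uniq a c d : M (a, c) -> M (a, d) -> c = d.
  move=> Mc Md'; have := Md _ _ _ _ Mc Md'; rewrite mulgV => /M1c h.
  by rewrite -[c]mulg1 -(mulVg d) mulgA h mul1g.
have bmul x x' : b (x * x')%g = (b x * b x')%g.
  apply: (uniq _ _ _ (bM _)).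
  by have := Md _ _ _ _ (bM x) (Md _ _ _ _ M1 (bM x')); rewrite !mul1g !invgK.
exists (mk_hom bmul); split.
  move=> x Sx; apply: (uniq _ _ _ (bM x)); left; exact: GS0.
by apply: (uniq _ _ _ (bM z)); left.
Qed.

(** If no nonzero power of x lies in S, x can be sent to -1. Otherwise the least such exponent d
    exceeds 1, and x can be sent to a nontrivial d-th root of unity. *)
Lemma hom_separates (S : set (circle R)) x : circle_subgroup S -> ~ S x ->
  exists b : Hom R, (forall y, S y -> b y = 1%g) /\ b x <> 1%g.
Proof.
move=> gS nSx; have [h|[d d0 [Sd dv]]] := subgroup_exponents x gS.
  have [y [y1 _]] := circle_minus_one R.
  have [|b [bS bx]] := @hom_extension S x y gS; first by move=> n /h ->.
  by exists b; rewrite bx.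
have d1 : (1 < d)%N.
  by rewrite ltn_neqAle d0 andbT; apply/eqP => d1; apply: nSx; move: Sd; rewrite -d1 expg1.
have [y yd y1] := circle_unity_root R d1.
have [|b [bS bx]] := @hom_extension S x y gS; last by exists b; rewrite bx.
by move=> n /dv[k ->]; rewrite circle_expzM /= yd circle_1expz.
Qed.

End HomExtension.

(** * Idempotents in compact semigroups *)

Section EllisNumakura.
Variables (G : topologicalType) (mul : G -> G -> G).
Hypothesis G_compact : compact [set: G].
Hypothesis G_hausdorff : hausdorff_space G.
Hypothesis mulA : forall a b c, mul a (mul b c) = mul (mul a b) c.
Hypothesis mul_continuous : forall b, continuous (mul^~ b).

Let closed_subsemigroup (C : set G) :=
  [/\ closed C, C !=set0 & forall a b, C a -> C b -> C (mul a b)].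

(** Let M be a minimal closed subsemigroup of C and p in M. Then M p is a closed subsemigroup, hence
    M, so the a in M with a p = p form a nonempty closed subsemigroup, hence again M; in particular
    p p = p. *)
Lemma closed_semigroup_idempotent C : closed C -> C !=set0 ->
  (forall a b, C a -> C b -> C (mul a b)) -> exists2 p, C p & mul p p = p.
Proof.
move=> C_closed C0 Cmul.
(* Minimality is obtained as maximality of the complement. *)
have [|A [[AC [p [Cp Ap]] Amul] Amax]] := @Zorn_bigcup _ [set U | closed_subsemigroup (C `&` ~` U)].
  move=> F FP Ftot; split.
  - rewrite setC_bigcup; have [->|/set0P F0] := eqVneq F set0.
      by rewrite bigcap_set0 setIT.
    rewrite -bigcapIr//; apply: closed_bigI => U FU.
    by have [] := FP _ FU.
  - apply: contrapT => ne.
    have CF : C `<=` \bigcup_(U in F) U.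
      by move=> x Cx; apply: contrapT => nx; apply: ne; exists x.
    (* By compactness, a chain covering C has a single member that covers C. The alternative
       [U = set0] accounts for an empty chain and for points outside C. *)
    pose P V := exists2 U, (F U \/ U = set0) & C `&` V `<=` U.
    suff [U FU] : P setT.
      rewrite setIT => CU; case: FU => [FU|U0].
        by have [_ [x [Cx nUx]] _] := FP _ FU; apply: nUx; exact: CU.
      by have [x /CU] := C0; rewrite U0.
    apply: compact_set_ind => //.
    + by exists set0; [right|rewrite setI0].
    + by move=> U V UV [W FW CW]; exists W => //; apply: subset_trans CW; exact: setIS.
    + move=> U V [W [FW|->] CW] [W' [FW'|->] CW'].
      * case: (Ftot _ _ FW FW') => WW'; [exists W'|exists W]; try (by left);
        rewrite setIUr subUset; split=> //; exact: subset_trans WW'.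
      * exists W; [by left|rewrite setIUr subUset; split=> //].
        by move=> x /CW'.
      * exists W'; [by left|rewrite setIUr subUset; split=> //].
        by move=> x /CW.
      * by exists set0; [by right|rewrite setIUr subUset; split].
    + move=> y; have [[U FU Uy]|nU] := pselect (exists2 U, F U & U y).
        exists (~` (C `&` ~` U)).
          apply: open_nbhs_nbhs; split; last by case.
          by apply: closed_openC; have [] := FP _ FU.
        by exists U; [left|move=> x [Cx nx]; apply: contrapT => nUx; exact: nx].
      exists (~` C); last by exists set0; [right|move=> x []].
      apply: open_nbhs_nbhs; split; first exact: closed_openC.
      by move=> /CF[U FU Uy]; apply: nU; exists U.
  - move=> a b [Ca Fa] [Cb Fb]; split; first exact: Cmul.
    move=> [U FU Uab]; have [_ _ h] := FP _ FU.
    have notin x : (~` \bigcup_(X in F) X) x -> (~` U) x by move=> nx Ux; apply: nx; exists U.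
    by have [] := h a b (conj Ca (notin a Fa)) (conj Cb (notin b Fb)).
pose M := C `&` ~` A.
have Mmul a b : M a -> M b -> M (mul a b) by exact: Amul.
have Mmin (D : set G) : closed_subsemigroup D -> D `<=` M -> M `<=` D.
  move=> gD DM x Mx; apply: contrapT => nDx; apply: (Amax (~` D)).
    split; first by move=> y Ay Dy; have [_] := DM _ Dy; exact.
    by move=> /(_ x nDx); exact: Mx.2.
  rewrite /= setCK (_ : C `&` D = D)//; apply/setIidPr => y /DM[].
  by [].
have Mp : M p by [].
pose D1 := [set mul a p | a in M].
have gD1 : closed_subsemigroup D1.
  split.
  - apply: compact_closed => //; apply: continuous_compact.
      by apply: continuous_subspaceT; exact: mul_continuous.
    by apply: subclosed_compact G_compact _ => //; exact: subsetT.
  - by exists (mul p p); exists p.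
  - move=> _ _ [a Ma <-] [b Mb <-]; exists (mul (mul a p) b).
      exact: (Mmul _ _ (Mmul _ _ Ma Mp) Mb).
    by rewrite !mulA.
have [|q Mq qp] := Mmin _ gD1 _ _ Mp; first by move=> _ [a Ma <-]; exact: Mmul.
pose D2 := [set a | M a /\ mul a p = p].
have gD2 : closed_subsemigroup D2.
  split.
  - rewrite (_ : D2 = M `&` [set a | mul a p = p])//; apply: closedI; first exact: AC.
    apply: (@closed_eq_hausdorff G G (mul^~ p) (fun=> p) G_hausdorff) => //.
    exact: cst_continuous.
  - by exists q.
  - by move=> a b [Ma ap] [Mb bp]; split; [exact: Mmul|rewrite -mulA bp].
by have [|_ pp] := Mmin _ gD2 _ _ Mp; [move=> a []|exists p].
Qed.

End EllisNumakura.

(** * The closure of the powers of 1 + t *)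

Section Star.
Variable R : realType.
Notation HN := {ptws nat -> Hom R}.
Implicit Types (P Q h : HN) (x : circle R).

Lemma hom_comp_proof (phi psi : Hom R) x y :
  phi (psi (x * y)%g) = (phi (psi x) * phi (psi y))%g.
Proof. by rewrite !homM. Qed.

Definition hom_comp (phi psi : Hom R) : Hom R := mk_hom (hom_comp_proof phi psi).

Definition hom_id : Hom R := @mk_hom R id (fun _ _ => erefl).

(** The sum of the first n terms P_i h_(k-i) of the coefficient of order k; addition of
    endomorphisms is the pointwise product, their multiplication is composition. *)
Fixpoint star_upto P h (k n : nat) : Hom R :=
  if n is n'.+1 then hom_mul (star_upto P h k n') (hom_comp (P n') (h (k - n')%N))
  else hom_one R.

(* The product of the power series P(t) and h(t) with coefficients in the ring
   of endomorphisms of the circle; hT is multiplication by 1 + t. *)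
Definition star P h : HN := fun k => star_upto P h k k.+1.

Definition star_one : HN := fun k => if k is 0 then hom_id else hom_one R.

Lemma star_uptoS P h k n x :
  star_upto P h k n.+1 x = (star_upto P h k n x * P n (h (k - n)%N x))%g.
Proof. by []. Qed.

Lemma hTS P k x : hT P k.+1 x = (P k x * P k.+1 x)%g. Proof. by []. Qed.

Lemma star_hT P h : star (hT P) h = hT (star P h).
Proof.
apply/funext => k; apply: hom_ext => x; case: k => [|k] //.
suff H n : star_upto (hT P) h k.+1 n.+1 x =
    (star_upto P h k n x * star_upto P h k.+1 n.+1 x)%g by exact: H.
elim: n => [|n IH]; first by rewrite /= !hom_mulE !mul1g.
rewrite star_uptoS IH hTS subSS !(star_uptoS _ _ _ n.+1) star_uptoS subSS.
by apply: cval_inj; rewrite !cvalM; ring.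
Qed.

Lemma star_hTinv P h : star (hTinv P) h = hTinv (star P h).
Proof. by rewrite -[LHS]hTK -star_hT hTinvK. Qed.

Lemma star_1l h : star star_one h = h.
Proof.
apply/funext => k; apply: hom_ext => x.
suff H n : star_upto star_one h k n.+1 x = h k x by exact: H.
by elim: n => [|n IH]; rewrite star_uptoS ?IH ?mulg1//= mul1g subn0.
Qed.

Lemma star_1r P : star P star_one = P.
Proof.
apply/funext => k; apply: hom_ext => x; rewrite /star star_uptoS subnn.
suff H n : (n <= k)%N -> star_upto P star_one k n x = 1%g by rewrite H// mul1g.
elim: n => // n IH nk; rewrite star_uptoS (IH (ltnW nk)) mul1g.
by case: (k - n)%N (subn_gt0 n k) => [|j _]; [rewrite nk|rewrite /= hom1].
Qed.

Lemma seq_eval_continuous k x : continuous (fun P : HN => P k x).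
Proof.
move=> P; apply: (@continuous_comp _ _ _ (fun P : HN => P k) (fun phi : Hom R => phi x)).
  exact: ptws_eval_continuous.
exact: hom_eval_continuous.
Qed.

Lemma seq_continuousP (Y : topologicalType) (F : Y -> HN) :
  (forall k x, continuous (fun t => F t k x)) -> continuous F.
Proof.
by move=> cF; apply: ptws_continuousP => k; apply: hom_continuousP => x; exact: cF.
Qed.

(** Only P varies: its coefficients are evaluated at points determined by h and x. In h the
    coefficients of P, which may be discontinuous, would intervene. *)
Lemma star_continuous h : continuous (star^~ h).
Proof.
apply: seq_continuousP => k x.
suff H n : continuous (fun P : HN => star_upto P h k n x) by exact: H.
elim: n => [|n IH]; first exact: cst_continuous.
by apply: circle_mul_continuous => //; exact: seq_eval_continuous.
Qed.

Lemma HN_hausdorff : hausdorff_space HN.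
Proof. exact/ptws_hausdorff/hom_hausdorff. Qed.

Lemma HN_compact : compact [set: HN].
Proof. exact/ptws_compact/hom_compact. Qed.

Lemma calH_closed : closed (calH R).
Proof.
apply: compact_closed; first exact: HN_hausdorff.
rewrite (_ : calH R = set_val @` [set: calH R]).
  apply: continuous_compact; last exact: (@space_compact (calH_system R)).
  by apply: continuous_subspaceT; exact: set_val_continuous.
rewrite eqEsubset; split=> [P HP|_ [P _ <-]]; last exact: set_valP.
by exists (SigSub (mem_set HP)).
Qed.

(* The closure of the orbit of 1 under the powers of hT, presented by its
   induction principle. *)
Definition one_orbit : set HN := [set P | forall C : set HN, closed C -> C star_one ->
  (forall Q, C Q -> C (hT Q)) -> (forall Q, C Q -> C (hTinv Q : HN)) -> C P].

Lemma one_orbit_closed : closed one_orbit.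
Proof.
move=> P clP C cC C1 CT CTi; apply: (cC).
by apply: (closure_subset _ clP) => Q OQ; exact: OQ.
Qed.

Lemma one_orbit_one : one_orbit star_one. Proof. by []. Qed.

Lemma one_orbit_hT P : one_orbit P -> one_orbit (hT P).
Proof. by move=> OP C cC C1 CT CTi; apply: (CT); exact: OP. Qed.

Lemma one_orbit_hTinv P : one_orbit P -> one_orbit (hTinv P : HN).
Proof. by move=> OP C cC C1 CT CTi; apply: (CTi); exact: OP. Qed.

Lemma star_one_calH : calH R star_one.
Proof.
split=> // -[//|k] x _ _; rewrite [LHS]/= big_nat.
elim/big_rec: _ => //. case=> [//|j] y _ y1; rewrite -y1 iterS. by exact: (esym (mulg1 _)).
Qed.

Lemma star_calH P h : one_orbit P -> calH R h -> calH R (star P h).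
Proof.
move=> OP Hh; apply: (OP [set P | calH R (star P h)]) => /=.
- by apply: (@closed_comp _ _ (star^~ h)) => [? _|]; [exact: star_continuous|exact: calH_closed].
- by rewrite star_1l.
- by move=> Q HQ; rewrite star_hT; exact: hT_calH.
- by move=> Q HQ; rewrite star_hTinv; exact: hTinv_calH.
Qed.

Lemma one_orbit_calH P : one_orbit P -> calH R P.
Proof. by move=> OP; rewrite -[P]star_1r; apply: star_calH => //; exact: star_one_calH. Qed.

Lemma one_orbit_star P Q : one_orbit P -> one_orbit Q -> one_orbit (star P Q).
Proof.
move=> OP OQ; apply: (OP [set P | one_orbit (star P Q)]) => /=.
- apply: (@closed_comp _ _ (star^~ Q)) => [? _|]; first exact: star_continuous.
  exact: one_orbit_closed.
- by rewrite star_1l.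
- by move=> P' HQ; rewrite star_hT; exact: one_orbit_hT.
- by move=> P' HQ; rewrite star_hTinv; exact: one_orbit_hTinv.
Qed.

(** Orbit induction replaces a rearrangement of double sums: both sides are continuous in P and
    compatible with [hT] and [hTinv]. *)
Lemma starA P Q h : one_orbit P -> star P (star Q h) = star (star P Q) h.
Proof.
move=> OP; apply: (OP [set P | star P (star Q h) = star (star P Q) h]) => /=.
- apply: closed_eq_hausdorff; [exact: HN_hausdorff|exact: star_continuous|].
  by move=> P'; apply: (@continuous_comp _ _ _ (star^~ Q) (star^~ h)); exact: star_continuous.
- by rewrite !star_1l.
- by move=> P' IH; rewrite !star_hT IH.
- by move=> P' IH; rewrite !star_hTinv IH.
Qed.

(* P(t) = 1 + O(t^m), for P with constant term 1. *)
Definition low (m : nat) P := forall j x, (0 < j < m)%N -> P j x = 1%g.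

Lemma low_le m n P : (n <= m)%N -> low m P -> low n P.
Proof. by move=> nm lP j x /andP[j0 jn]; apply: lP; rewrite j0 (leq_trans jn). Qed.

Lemma low_succ m P : low m P -> (forall x, P m x = 1%g) -> low m.+1 P.
Proof.
move=> lP Pm j x /andP[j0]; rewrite ltnS leq_eqVlt => /predU1P[->//|jm].
by apply: lP; rewrite j0.
Qed.

(** * Coefficients of a product with a factor 1 + O(t^m) *)

Section LowOrder.
Variables (P h : HN).
Hypotheses (P0 : forall x, P 0%N x = x) (h0 : forall x, h 0%N x = x).

Lemma star0 x : star P h 0%N x = x.
Proof. by rewrite /star star_uptoS mul1g P0 h0. Qed.

Lemma star_upto_lowl m k n x : low m P -> (0 < n <= m)%N -> star_upto P h k n x = h k x.
Proof.
move=> lP; elim: n => // -[|n] IH nm; first by rewrite star_uptoS mul1g P0 subn0.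
by rewrite star_uptoS IH; [rewrite lP ?mulg1|exact: (ltnW nm)].
Qed.

Lemma star_lowl m k x : low m P -> (k < m)%N -> star P h k x = h k x.
Proof. by move=> lP km; exact: (star_upto_lowl _ _ lP). Qed.

Lemma star_lowl_eq m x : (0 < m)%N -> low m P -> star P h m x = (h m x * P m x)%g.
Proof.
by move=> m0 lP; rewrite /star star_uptoS (star_upto_lowl _ _ lP) ?m0//= subnn h0.
Qed.

(** The middle term is P_m h_1 here and P_1 h_m in [star_lowr_succ]; comparing the two produces
    commutators of endomorphisms. *)
Lemma star_lowl_succ m x : (0 < m)%N -> low m P ->
  star P h m.+1 x = (h m.+1 x * P m (h 1%N x) * P m.+1 x)%g.
Proof.
move=> m0 lP; rewrite /star 2!star_uptoS (star_upto_lowl _ _ lP) ?m0//=.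
by rewrite subnn h0 subSnn.
Qed.

Lemma star_upto_lowr m k n x : low m h -> (0 < n <= k)%N -> (k <= m)%N ->
  star_upto P h k n x = h k x.
Proof.
move=> lh + km; elim: n => // -[|n] IH nk; first by rewrite star_uptoS mul1g P0 subn0.
rewrite star_uptoS IH; last exact: (ltnW nk).
have /andP[_ nk'] := nk; rewrite (lh (k - n.+1)%N) ?hom1 ?mulg1// subn_gt0 nk' /=.
by apply: leq_trans km; rewrite ltn_subrL /= (leq_trans _ nk').
Qed.

Lemma star_lowr_eq m x : (0 < m)%N -> low m h -> star P h m x = (h m x * P m x)%g.
Proof.
by move=> m0 lh; rewrite /star star_uptoS (star_upto_lowr _ lh) ?m0 ?leqnn//= subnn h0.
Qed.

Lemma star_lowr m k x : low m h -> (k < m)%N -> star P h k x = P k x.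
Proof.
case: k => [|k] lh km; first by rewrite star0 P0.
by rewrite (star_lowr_eq _ _ (low_le (ltnW km) lh))// lh ?mul1g.
Qed.

Lemma star_lowr_succ m x : (0 < m)%N -> low m h ->
  star P h m.+1 x = (h m.+1 x * P 1%N (h m x) * P m.+1 x)%g.
Proof.
move=> m0 lh; rewrite /star star_uptoS subnn h0; congr (_ * _)%g.
suff H n : (1 < n <= m.+1)%N -> star_upto P h m.+1 n x = (h m.+1 x * P 1%N (h m x))%g.
  by apply: H; rewrite ltnS m0 leqnn.
elim: n => // -[|[|n]] IH // nm.
  by rewrite 2!star_uptoS mul1g subn0 P0 subn1.
rewrite star_uptoS IH; last exact: (ltnW nm).
have /andP[_ nm'] := nm; rewrite (lh (m.+1 - n.+2)%N) ?hom1 ?mulg1// subn_gt0 nm' /=.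
by rewrite subSS ltn_subrL m0.
Qed.

End LowOrder.

Lemma one_orbit0 P x : one_orbit P -> P 0%N x = x.
Proof. by move=> /one_orbit_calH[]. Qed.

(** Once C is 1 below order m, the coefficient of order m of C B is B_m + C_m, so equality with B_m
    forces C_m to vanish. *)
Lemma star_quotient_low C A B m : one_orbit C -> one_orbit B -> star C B = A ->
  (forall j x, (j < m)%N -> A j x = B j x) -> low m C.
Proof.
move=> OC OB CBA AB.
have c0 x := one_orbit0 x OC; have b0 x := one_orbit0 x OB.
elim: m AB => [|m IH] AB; first by move=> j x; rewrite ltn0 andbF.
have lC : low m C by apply: IH => j x jm; apply: AB; exact: ltnW.
have [->|m0] := posnP m; first by move=> [|j] x /andP[]//.
apply: low_succ => // x; apply: (mulgI (B m x)).
by rewrite mulg1 -(star_lowl_eq c0 b0 _ m0 lC) CBA AB.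
Qed.

Lemma star_idempotent P : one_orbit P -> star P P = P -> P = star_one.
Proof.
move=> OP PP; apply/funext => k; apply: hom_ext => x.
have lP := star_quotient_low (m := k.+1) OP OP PP (fun _ _ _ => erefl).
by case: k lP => [|k] lP; [rewrite one_orbit0|rewrite lP//= ltnSn].
Qed.

(* The closed semigroup [star^~ Q @` one_orbit] contains an idempotent, and 1 is
   the only idempotent power series with constant term 1. *)
Lemma one_orbit_linv Q : one_orbit Q -> exists2 P, one_orbit P & star P Q = star_one.
Proof.
move=> OQ.
pose mul (a b : one_orbit) : one_orbit :=
  SigSub (mem_set (one_orbit_star (set_valP a) (set_valP b))).
have Gcompact : compact [set: one_orbit].
  apply: compact_set_type; apply: subclosed_compact HN_compact _ => //.
  exact: one_orbit_closed.
have Ghausdorff : hausdorff_space one_orbit by exact/hausdorff_set_type/HN_hausdorff.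
have mulA a b c : mul a (mul b c) = mul (mul a b) c.
  by apply: set_val_inj; exact: (starA _ _ (set_valP a)).
have cmul b : continuous (mul^~ b).
  apply: set_val_continuousP => a.
  apply: (@continuous_comp _ _ _ set_val (star^~ (set_val b))); first exact: set_val_continuous.
  exact: star_continuous.
pose q : one_orbit := SigSub (mem_set OQ).
have [||a b [a' _ <-] [b' _ <-]|p [a _ ap] pp] :=
  closed_semigroup_idempotent Gcompact Ghausdorff mulA cmul
  (C := (mul^~ q) @` setT).
- apply: compact_closed => //; apply: continuous_compact => //.
  by apply: continuous_subspaceT; exact: cmul.
- by exists (mul q q); exists q.
- by exists (mul (mul a' q) b') => //; rewrite !mulA.
exists (set_val a); first exact: set_valP.
have <- : set_val p = star_one.
  by apply: star_idempotent; [exact: set_valP|rewrite -[in RHS]pp].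
by rewrite -ap.
Qed.

Lemma one_orbit_inv Q : one_orbit Q ->
  exists P, [/\ one_orbit P, star P Q = star_one & star Q P = star_one].
Proof.
move=> OQ; have [P OP PQ] := one_orbit_linv OQ; have [Q' OQ' Q'P] := one_orbit_linv OP.
exists P; split=> //; suff -> : Q = Q' by [].
by rewrite -[Q']star_1r -PQ starA// Q'P star_1l.
Qed.

(** With phi_1 trivial, the defining relations of H make phi_k trivial at y^(k!), and every root of
    unity has this form. *)
Lemma one_orbit_low_rational P k x : one_orbit P -> low 2 P -> (0 < k)%N ->
  rational_circle x -> P k x = 1%g.
Proof.
move=> OP lP k0 /(rational_circle_root (fact_gt0 k))[y yQ <-].
have [_ /(_ k y k0 yQ) ->] := one_orbit_calH OP.
rewrite big_nat; elim/big_rec: _ => // -[//|j] z _ ->.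
by rewrite iterS lP ?mul1g.
Qed.

End Star.

(** * Closed normal subgroups *)

Section NormalSubgroup.
Variable R : realType.
Notation HN := {ptws nat -> Hom R}.
Implicit Types (P Q a b c k : HN) (x y z : circle R).

Lemma low_closed m : closed [set P : HN | low m P].
Proof.
rewrite (_ : [set P | low m P] =
  \bigcap_j \bigcap_x [set P : HN | (0 < j < m)%N -> P j x = 1%g]).
  apply: closed_bigI => j _; apply: closed_bigI => x _.
  case: (boolP (0 < j < m)%N) => jm; last first.
    rewrite (_ : [set P | _] = setT); first exact: closedT.
    by rewrite eqEsubset; split.
  rewrite (_ : [set P | _] = [set P : HN | P j x = 1%g]).
    apply: closed_eq_hausdorff; first exact: circle_hausdorff.
      exact: seq_eval_continuous.
    exact: cst_continuous.
  by rewrite eqEsubset; split=> [P|P] /= h => [|_]; exact: h.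
rewrite eqEsubset; split=> [P lP j _ x _|P lP j x]; first exact: lP.
exact: lP.
Qed.

Lemma image_coef_closed (A : set HN) m : closed A -> closed [set P m | P in A].
Proof.
move=> cA; apply: compact_closed; first exact: hom_hausdorff.
apply: (@continuous_compact _ _ (fun P : HN => P m)).
  by apply: continuous_subspaceT => P; exact: ptws_eval_continuous.
by apply: subclosed_compact (@HN_compact R) _.
Qed.

(** The first coefficients form a closed subgroup containing the identity map, which comes from 1 +
    t; its annihilator is therefore trivial. *)
Lemma one_orbit_coef1_surj (phi : Hom R) : exists2 a, one_orbit a & a 1%N = phi.
Proof.
suff [a Oa <-] : [set P 1%N | P in @one_orbit R] phi by exists a.
have l1 P : low 1 P by move=> [|[]].
have coef1 P Q x : one_orbit P -> one_orbit Q -> star P Q 1%N x = (Q 1%N x * P 1%N x)%g.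
  move=> OP OQ; apply: star_lowl_eq => // y; exact: one_orbit0.
apply: hom_double_annihilator.
- exact: image_coef_closed (@one_orbit_closed R).
- by exists (star_one R).
- move=> _ _ [P OP <-] [Q OQ <-]; have [Q' [OQ' Q'Q _]] := one_orbit_inv OQ.
  exists (star P Q'); first exact: one_orbit_star.
  apply: hom_ext => x; rewrite hom_divE coef1// circle_mulC; congr (_ * _)%g.
  apply: (mulgI (Q 1%N x)).
  have /(congr1 (fun P : HN => P 1%N x)) := Q'Q.
  by rewrite coef1// mulgV.
- move=> x h; suff -> : x = 1%g by rewrite hom1.
  have := h (hT (star_one R) 1%N); rewrite hTS mulg1; apply.
  by exists (hT (star_one R)) => //; exact: (one_orbit_hT (@one_orbit_one R)).
Qed.

Variable K : set HN.
Hypothesis K_orbit : forall k, K k -> one_orbit k.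
Hypothesis K_closed : closed K.
Hypothesis K_one : K (star_one R).
Hypothesis K_star : forall k k', K k -> K k' -> K (star k k').
Hypothesis K_linv : forall k, K k -> exists2 k', K k' & star k' k = star_one R.
(** The equation says that c is the commutator a k a^-1 k^-1, without naming inverses. *)
Hypothesis K_normal : forall k a c, K k -> one_orbit a -> one_orbit c ->
  star c (star k a) = star a k -> K c.

Let o0 P : one_orbit P -> forall x, P 0%N x = x.
Proof. by move=> OP x; exact: one_orbit0. Qed.

(* The coefficients of order m of the elements 1 + k_m t^m + ... of K. *)
Let N (m : nat) : set (Hom R) := [set k m | k in K `&` [set P | low m P]].

Let N_closed m : closed (N m).
Proof. by apply: image_coef_closed; apply: closedI => //; exact: low_closed. Qed.

Let low_one m : low m (star_one R).
Proof. by move=> [|j]. Qed.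

Let N_one m : (0 < m)%N -> N m (hom_one R).
Proof. by case: m => // m _; exists (star_one R); first by split=> //; exact: low_one. Qed.

Let quotient P Q m : one_orbit P -> one_orbit Q -> (0 < m)%N ->
  (forall j x, (j < m)%N -> P j x = Q j x) ->
  exists c, [/\ one_orbit c, star c Q = P, low m c &
    forall x, P m x = (Q m x * c m x)%g].
Proof.
move=> OP OQ m0 PQ; have [Q' [OQ' Q'Q _]] := one_orbit_inv OQ.
have Oc : one_orbit (star P Q') by exact: one_orbit_star.
have cQ : star (star P Q') Q = P by rewrite -starA// Q'Q star_1r.
have lc := star_quotient_low Oc OQ cQ PQ.
exists (star P Q'); split=> // x.
by rewrite -{1}cQ (star_lowl_eq (o0 Oc) (o0 OQ)).
Qed.

Let low_agree P Q m : one_orbit P -> one_orbit Q -> low m P -> low m Q ->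
  forall j x, (j < m)%N -> P j x = Q j x.
Proof. by move=> OP OQ lP lQ [|j] x jm; rewrite ?o0// lP// lQ. Qed.

Let N_div m phi psi : (0 < m)%N -> N m phi -> N m psi -> N m (hom_div phi psi).
Proof.
move=> m0 [k [Kk lk] <-] [k' [Kk' lk'] <-].
have [k'' Kk'' k''k'] := K_linv Kk'.
have lk'' : low m k''.
  apply: (star_quotient_low (K_orbit Kk'') (K_orbit Kk') k''k').
  by apply: low_agree => //; exact: K_orbit.
have h1 := o0 (K_orbit Kk); have h2 := o0 (K_orbit Kk'); have h3 := o0 (K_orbit Kk'').
exists (star k k'').
  split; first exact: K_star.
  by move=> j x /andP[j0 jm]; rewrite (star_lowl _ h1 _ lk)// lk''// j0.
apply: hom_ext => x; rewrite (star_lowl_eq h1 h3)// hom_divE circle_mulC; congr (_ * _)%g.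
apply: (mulgI (k' m x)); rewrite mulgV -(star_lowl_eq h3 h2 _ m0 lk'') k''k'.
by case: m m0 {lk lk' lk''}.
Qed.

Let N_annihilator m (phi : Hom R) : (0 < m)%N ->
  (forall x, (forall psi, N m psi -> psi x = 1%g) -> phi x = 1%g) -> N m phi.
Proof.
move=> m0; apply: hom_double_annihilator; first exact: N_closed.
  exact: N_one.
by move=> ? ?; exact: N_div.
Qed.

(** Take a in the orbit closure with a_1 = b, and c with c (k a) = a k. The products agree up to
    order m, and at order m + 1 they differ by b k_m - k_m b, which is thus the coefficient
    c_(m+1). *)
Let N_commutator m (phi b : Hom R) z : (0 < m)%N -> N m phi ->
  (forall psi, N m.+1 psi -> psi z = 1%g) -> b (phi z) = phi (b z).
Proof.
move=> m0 [k [Kk lk] <-] Nz; have [a Oa <-] := one_orbit_coef1_surj b.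
have Ok := K_orbit Kk; have hk := o0 Ok; have ha := o0 Oa.
have [|c [Oc cE lc cm]] := @quotient (star a k) (star k a) m.+1
    (one_orbit_star Oa Ok) (one_orbit_star Ok Oa) isT.
  move=> j x; rewrite ltnS leq_eqVlt => /predU1P[->|jm].
    by rewrite (star_lowl_eq hk ha)// (star_lowr_eq ha hk)// circle_mulC.
  by rewrite (star_lowl _ hk _ lk)// (star_lowr ha hk _ lk).
have Kc := K_normal Kk Oa Oc cE.
have cz : c m.+1 z = 1%g by apply: Nz; exists c.
have := cm z; rewrite cz mulg1 (star_lowl_succ hk ha)// (star_lowr_succ ha hk)// => h.
apply: (mulgI (k m.+1 z)); apply: (mulIg (a m.+1 z)); rewrite h.
by apply: cval_inj; rewrite !cvalM; ring.
Qed.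

Let torsion : set (circle R) := [set x | exists2 n, (0 < n)%N & (x ^+ n)%g = 1%g].

Let torsion_subgroup : circle_subgroup torsion.
Proof.
split; first by exists 1%N.
move=> x y [n n0 xn] [m m0 ym]; exists (n * m)%N; first by rewrite muln_gt0 n0.
apply: cval_inj; rewrite cvalX cvalM cvalV exprMn exprVn -!cvalX.
rewrite circle_expM xn mulnC circle_expM ym.
by rewrite !cvalX cval1 !expr1n invr1 mulr1.
Qed.

Let trivial_subgroup : circle_subgroup [set (1%g : circle R)].
Proof. by split=> // x y -> ->; rewrite mulgV. Qed.

(* If z is a nontorsion element of the annihilator of N (m + 1), phi commutes at
   z with every endomorphism, hence is a power map x |-> x^n; then N m contains
   every phi o b, and one of them does not commute at z with the endomorphism
   fixing z and killing the torsion. *)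
Let N_step m (phi : Hom R) x0 (v : Hom R) : (0 < m)%N -> N m phi -> phi x0 <> 1%g ->
  (forall x, rational_circle x -> v x = 1%g) -> N m.+1 v.
Proof.
move=> m0 Nphi phix0 vQ; apply: N_annihilator => // z Nz; apply: vQ.
apply: contrapT => zQ.
have z_free (n : int) : z ^z n = 1%g -> n = 0.
  case: n => [[//|n]|n] zn; exfalso; apply: zQ; apply: (@torsion_rational_circle R z n.+1) => //.
  by rewrite -[LHS]invgK; move: zn => /= ->; rewrite invg1.
have comm (psi b : Hom R) : N m psi -> b (psi z) = psi (b z).
  by move=> Npsi; exact: (@N_commutator m psi b z m0 Npsi Nz).
pose Z : set (circle R) := [set z ^z n | n in setT].
have gZ : circle_subgroup Z.
  split; first by exists 0.
  by move=> _ _ [n _ <-] [k _ <-]; exists (n - k) => //; rewrite circle_expzB.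
(* Otherwise some b kills the powers of z but not phi(z), while phi(b(z)) = 1. *)
have [n _ phiz] : Z (phi z).
  apply: contrapT => nZ; have [b [bZ]] := hom_separates gZ nZ; apply.
  by rewrite comm// bZ ?hom1//; exists 1 => //; exact: circle_expz1.
have free_ext y : exists b : Hom R, b z = y.
  have [|b [_ bz]] := @hom_extension R [set 1%g] z y trivial_subgroup.
    by move=> k /= /z_free ->.
  by exists b.
have phiE y : phi y = y ^z n.
  by have [b <-] := free_ext y; rewrite -comm// -phiz homXz.
have n0 : n <> 0 by move=> n0; apply: phix0; rewrite phiE n0.
(* w is chosen so that w^n has order 2. With b(z) = w and c fixing z and killing torsion,
   c(phi(b(z))) = 1 but phi(b(c(z))) = w^n. *)
have [y [y1 yy]] := circle_minus_one R.
have n0' : (0 < `|n|)%N by rewrite absz_gt0; apply/eqP.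
have [w wn] := circle_root y n0'.
have wn1 : w ^z n <> 1%g.
  move=> h; apply: y1; rewrite -wn; case: n h {phiz phiE n0 n0' wn} => n //= h.
  by rewrite -[LHS]invgK h invg1.
have wtor : torsion (w ^z n).
  apply: subgroup_expz; first exact: torsion_subgroup.
  exists (`|n| * 2)%N; first by rewrite muln_gt0 n0'.
  by rewrite circle_expM wn expgS expg1.
have [b bz] := free_ext w.
have [|c [ctor cz]] := @hom_extension R torsion z z torsion_subgroup.
  move=> k [j j0 zj]; have /z_free/eqP : z ^z (k * j%:Z) = 1%g by rewrite circle_expzM.
  by rewrite mulf_eq0 eqz_nat (gtn_eqF j0) orbF => /eqP ->.
(* An x annihilated by [N m] satisfies x^n = 1, hence phi(b(x)) = b(x^n) = 1. *)
have Npsi : N m (hom_comp phi b).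
  apply: N_annihilator => // x /(_ _ Nphi); rewrite phiE => xn.
  by rewrite [LHS](phiE (b x)) -homXz xn hom1.
have := comm _ c Npsi; rewrite cz.
have -> : hom_comp phi b z = w ^z n by rewrite -bz -phiE.
by rewrite ctor// => h; apply: wn1.
Qed.

(** [N_step] is applied to phi at order m and then, as long as v is nontrivial, to v itself at the
    higher orders. *)
Let N_above m (phi : Hom R) x0 (v : Hom R) M : (0 < m)%N -> N m phi -> phi x0 <> 1%g ->
  (forall x, rational_circle x -> v x = 1%g) -> (m < M)%N -> N M v.
Proof.
move=> m0 Nphi phix0 vQ; elim: M => // M IH.
rewrite ltnS leq_eqVlt => /predU1P[<-|mM]; first exact: N_step phix0 vQ.
have M0 : (0 < M)%N by exact: leq_ltn_trans mM.
have [[x vx]|vn] := pselect (exists x, v x <> 1%g).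
  exact: N_step (IH mM) vx vQ.
suff -> : v = hom_one R by exact: N_one.
by apply: hom_ext => x; apply: contrapT => vx; apply: vn; exists x.
Qed.

(* l is the limit of the elements of K obtained by dividing it successively by
   elements of K with the same leading term. *)
Let K_contains_low m (phi : Hom R) x0 l : (0 < m)%N -> N m phi -> phi x0 <> 1%g ->
  one_orbit l -> low m.+1 l -> K l.
Proof.
move=> m0 Nphi phix0 Ol ll.
have approx i : exists k, K k /\ exists r, [/\ one_orbit r, low (m.+1 + i) r & l = star r k].
  elim: i => [|i [k [Kk [r [Or lr lE]]]]].
    by exists (star_one R); split=> //; exists l; split; rewrite ?addn0 ?star_1r.
  have M0 : (0 < m.+1 + i)%N by [].
  have [|k' [Kk' lk'] k'E] :=
    @N_above m phi x0 (r (m.+1 + i)%N) (m.+1 + i)%N m0 Nphi phix0 _ (leq_addr _ _).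
    move=> x xQ; apply: one_orbit_low_rational => //.
    by apply: low_le lr; rewrite addSn ltnS (leq_trans m0)// leq_addr.
  have [r' [Or' r'E lr' r'm]] := quotient Or (K_orbit Kk') M0 (low_agree Or (K_orbit Kk') lr lk').
  exists (star k' k); split; first exact: K_star.
  exists r'; split=> //; last by rewrite starA// r'E.
  rewrite addnS; apply: low_succ => // x.
  by have := r'm x; rewrite k'E => /esym h; apply: (mulgI (r (m.+1 + i)%N x)); rewrite h mulg1.
have /choice[k kP] := approx.
have K_compact : compact K by apply: subclosed_compact (@HN_compact R) _.
have FK : (k @ \oo) K by exists 0%N => // i _; exact: (kP i).1.
have [p [Kp clp]] := K_compact (k @ \oo) _ FK.
suff -> : l = p by [].
apply/funext => j; apply: hom_ext => x.
have cC : closed [set P : HN | l j x = P j x].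
  apply: closed_eq_hausdorff; first exact: circle_hausdorff.
    exact: cst_continuous.
  exact: seq_eval_continuous.
apply: cC => B nB; apply: clp nB.
exists j => // i /= ji; have [_ [r [Or lr ->]]] := kP i.
rewrite (star_lowl _ (o0 Or) _ lr)//.
by rewrite addSn ltnS (leq_trans ji)// leq_addl.
Qed.

Let invariant j x := forall k a, K k -> one_orbit a -> star k a j x = a j x.

(** All coefficients below the least order m of [K] are invariant, as are those of order m at points
    annihilated by [N m]. So c = a b^-1 is 1 below order m and has c_m in [N m]. Dividing c by an
    element of [K] with the same leading coefficient leaves 1 + O(t^(m+1)), which lies in [K]. *)
Lemma normal_subgroup_separates a b : one_orbit a -> one_orbit b ->
  (forall j x, invariant j x -> a j x = b j x) -> exists2 k, K k & a = star k b.
Proof.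
move=> Oa Ob ab.
have [[m0 [m0_gt0 [k0 Kk0 [x0 k0x0]]]]|Ktriv] :=
    pselect (exists m, (0 < m)%N /\ exists2 k, K k & exists x, k m x <> 1%g); last first.
  exists (star_one R) => //; rewrite star_1l; apply/funext => j; apply: hom_ext => x.
  apply: ab => k c Kk Oc; suff -> : k = star_one R by rewrite star_1l.
  apply/funext => -[|i]; apply: hom_ext => y; first by rewrite o0//; exact: K_orbit.
  by apply: contrapT => ky; apply: Ktriv; exists i.+1; split=> //; exists k => //; exists y.
have ex : exists m, `[< (0 < m)%N /\ exists2 k, K k & exists x, k m x <> 1%g >].
  by exists m0; apply/asboolP; split=> //; exists k0 => //; exists x0.
case: (ex_minnP ex) => m /asboolP[m_gt0 [k1 Kk1 [x1 k1x1]]] mmin.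
have lowK k : K k -> low m k.
  move=> Kk j x /andP[j0 jm]; apply: contrapT => kx.
  have : (m <= j)%N by apply: mmin; apply/asboolP; split=> //; exists k => //; exists x.
  by rewrite leqNgt jm.
have Nk1 : N m (k1 m) by exists k1 => //; split=> //; exact: lowK.
have abm j x : (j < m)%N -> a j x = b j x.
  move=> jm; apply: ab => k c Kk Oc.
  by rewrite (star_lowl _ (o0 (K_orbit Kk)) _ (lowK _ Kk)).
have [c [Oc cb lc cm]] := quotient Oa Ob m_gt0 abm.
have [k [Kk lk] kE] : N m (c m).
  apply: N_annihilator => // x Nx; apply: (mulgI (b m x)); rewrite -cm mulg1.
  apply: ab => k d Kk Od.
  rewrite (star_lowl_eq (o0 (K_orbit Kk)) (o0 Od) x m_gt0 (lowK _ Kk)) (Nx (k m)) ?mulg1//.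
  by exists k => //; split=> //; exact: lowK.
have [r [Or rE lr rm]] := quotient Oc (K_orbit Kk) m_gt0 (low_agree Oc (K_orbit Kk) lc lk).
exists c => //; rewrite -rE; apply: K_star => //.
apply: (K_contains_low m_gt0 Nk1 k1x1 Or).
apply: low_succ => // x; apply: (mulgI (k m x)).
by rewrite -rm kE mulg1.
Qed.

End NormalSubgroup.

(** * The enveloping semigroup *)

Section QuasiEigen.
Variables (R : realType) (Y : dynSys).
Implicit Types (g h : Y -> circle R).

Lemma quasi_eigen_continuous m g : quasi_eigen R Y m g -> continuous g.
Proof. by case: m => [[c ->]|m []//]; exact: cst_continuous. Qed.

Lemma quasi_eigen_succ m g : quasi_eigen R Y m g -> quasi_eigen R Y m.+1 g.
Proof.
elim: m g => [|m IH] g.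
  move=> [c ->]; split; first exact: cst_continuous.
  by exists (cst 1%g); [exists 1%g|move=> x; rewrite mul1g].
by move=> [cg [f qf gE]]; split=> //; exists f => //; exact: IH.
Qed.

Lemma quasi_eigen_le m n g : (m <= n)%N -> quasi_eigen R Y m g -> quasi_eigen R Y n g.
Proof.
move=> /subnK <-; elim: (n - m)%N => // k IH qg.
by rewrite addSn; apply: quasi_eigen_succ; exact: IH.
Qed.

Lemma quasi_eigen_mul m g h : quasi_eigen R Y m g -> quasi_eigen R Y m h ->
  quasi_eigen R Y m (fun x => (g x * h x)%g).
Proof.
elim: m g h => [|m IH] g h; first by move=> [c ->] [d ->]; exists (c * d)%g.
move=> [cg [f qf gE]] [ch [k qk hE]]; split; first exact: circle_mul_continuous.
exists (fun x => (f x * k x)%g); first exact: IH.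
by move=> x; rewrite gE hE; apply: cval_inj; rewrite !cvalM; ring.
Qed.

Lemma quasi_eigen_inv m g : quasi_eigen R Y m g -> quasi_eigen R Y m (fun x => (g x)^-1%g).
Proof.
elim: m g => [|m IH] g; first by move=> [c ->]; exists (c^-1)%g.
move=> [cg [f qf gE]]; split; first exact: circle_inv_continuous.
exists (fun x => (f x)^-1%g); first exact: IH.
by move=> x; rewrite gE; apply: cval_inj; rewrite !(cvalM, cvalV) invfM.
Qed.

Lemma quasi_eigens_separate :
  (forall x y : Y, x <> y -> exists2 g, quasi_eigens R Y g & g x <> g y) ->
  quasi_discrete_spectrum R Y.
Proof.
move=> sep f cf B /uniform_nbhs[E [entE EB]].
move: entE; rewrite -entourage_ballE => -[e /= e0 eE].
have eR : e = (complex.Re e)%:C by move: e0; rewrite ltcE => /andP[/eqP] /=; case: (e) => a b /= ->.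
have e0' : 0 < complex.Re e by rewrite -ltcR -eR.
have [|||||v Lv fv] :=
  @circle_stone_weierstrass R Y (quasi_eigens R Y) (@space_compact Y) _ _ _ _
    sep f cf (complex.Re e / 2).
- by move=> g [m _]; exact: quasi_eigen_continuous.
- by exists 0%N => //; exists 1%g.
- move=> g h [m _ qg] [n _ qh]; exists (maxn m n) => //; apply: quasi_eigen_mul.
    by apply: quasi_eigen_le qg; exact: leq_maxl.
  by apply: quasi_eigen_le qh; exact: leq_maxr.
- by move=> g [m _ qg]; exists m => //; exact: quasi_eigen_inv.
- by lra.
exists v; split=> //; apply: EB => y _; apply: eE => /=.
by apply: le_lt_trans (fv y) _; rewrite [X in _ < X]eR ltcR; lra.
Qed.

End QuasiEigen.

(** A continuous surjection from a compact space to a Hausdorff space is closed, hence a quotient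
    map. *)
Lemma continuous_quotient (A B C : topologicalType) (f : A -> B) (g : B -> C) :
  compact [set: A] -> hausdorff_space B -> continuous f -> (forall b, exists a, f a = b) ->
  continuous (g \o f) -> continuous g.
Proof.
move=> cA hB cf sf cgf; apply/continuous_closedP => D cD.
have -> : g @^-1` D = f @` ((g \o f) @^-1` D).
  rewrite eqEsubset; split=> [b Db|_ [a Da <-]//].
  by have [a ab] := sf b; exists a; rewrite //= ab.
apply: compact_closed => //; apply: continuous_compact; first exact: continuous_subspaceT.
apply: subclosed_compact cA _ => //.
exact: (continuous_closedP _).1.
Qed.

(** * The orbit closure acting on a factor of H *)

Section Factor.
Variables (R : realType) (X : dynSys) (pi : calH_system R -> X).
Hypothesis pi_continuous : continuous pi.
Hypothesis pi_surj : forall x, exists h, pi h = x.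
Hypothesis pi_dyn : forall h, pi (dyn h) = dyn (pi h).
Notation HN := {ptws nat -> Hom R}.
Notation orb := (@one_orbit R).
Implicit Types (p q : orb) (h : calH R).

Let orb_one : orb := SigSub (mem_set (@one_orbit_one R)).
Let orb_T p : orb := SigSub (mem_set (one_orbit_hT (set_valP p))).
Let orb_Tinv p : orb := SigSub (mem_set (one_orbit_hTinv (set_valP p))).
Let orb_mul p q : orb := SigSub (mem_set (one_orbit_star (set_valP p) (set_valP q))).
Let act p h : calH R := SigSub (mem_set (star_calH (set_valP p) (set_valP h))).

Let orb_compact : compact [set: orb].
Proof.
apply: compact_set_type; apply: subclosed_compact (@HN_compact R) _ => //.
exact: one_orbit_closed.
Qed.

Let orb_ind (D : set orb) : closed D -> D orb_one -> (forall p, D p -> D (orb_T p)) ->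
  (forall p, D p -> D (orb_Tinv p)) -> forall p, D p.
Proof.
move=> cD D1 DT DTi p; have [] : (set_val @` D) (set_val p).
- apply: (set_valP p).
  + apply: compact_closed; first exact: HN_hausdorff.
    apply: continuous_compact; last exact: subclosed_compact orb_compact _.
    by apply: continuous_subspaceT; exact: set_val_continuous.
  + by exists orb_one.
  + by move=> _ [q Dq <-]; exists (orb_T q) => //; exact: DT.
  + by move=> _ [q Dq <-]; exists (orb_Tinv q) => //; exact: DTi.
- by move=> q Dq /set_val_inj <-.
Qed.

Let act_one h : act orb_one h = h.
Proof. by apply: set_val_inj; exact: star_1l. Qed.

Let act_T p h : act (orb_T p) h = calH_T (act p h).
Proof. by apply: set_val_inj; exact: star_hT. Qed.

Let act_Tinv p h : act (orb_Tinv p) h = calH_Tinv (act p h).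
Proof. by apply: set_val_inj; exact: star_hTinv. Qed.

Let act_mul p q h : act (orb_mul p q) h = act p (act q h).
Proof. by apply: set_val_inj; exact: (esym (starA _ _ (set_valP p))). Qed.

Let act_continuous h : continuous (act^~ h).
Proof.
apply: set_val_continuousP.
move=> p; apply: (@continuous_comp _ _ _ set_val ((@star R)^~ (set_val h))).
  exact: set_val_continuous.
exact: star_continuous.
Qed.

Let piT h : pi (calH_T h) = dyn (pi h). Proof. exact: pi_dyn. Qed.

Let piTinv h : pi (calH_Tinv h) = dyn_inv (pi h).
Proof.
rewrite -[LHS](@dynK X) -piT; congr (dyn_inv (pi _)).
exact: (@dyn_invK (calH_system R)).
Qed.

Let pi_act_continuous h : continuous (fun p => pi (act p h)).
Proof.
move=> p; apply: (@continuous_comp _ _ _ (act^~ h) pi); first exact: act_continuous.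
exact: pi_continuous.
Qed.

Let sec := projT1 (choice pi_surj).
Let secK x : pi (sec x) = x. Proof. exact: (projT2 (choice pi_surj)). Qed.

Let theta p : {ptws X -> X} := fun x => pi (act p (sec x)).

(** The action on H descends along pi: this holds for the powers of 1 + t and passes to limits, so
    the choice of the section [sec] is immaterial. *)
Let thetaE p h : theta p (pi h) = pi (act p h).
Proof.
apply: (@orb_ind [set p | theta p (pi h) = pi (act p h)]) => /=.
- apply: closed_eq_hausdorff; first exact: space_hausdorff.
    exact: pi_act_continuous.
  exact: pi_act_continuous.
- by rewrite /theta !act_one secK.
- by move=> q; rewrite /theta !act_T !piT => ->.
- by move=> q; rewrite /theta !act_Tinv !piTinv => ->.
Qed.

Let theta_continuous : continuous theta.
Proof. by apply: ptws_continuousP => x; exact: pi_act_continuous. Qed.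

Let theta_one x : theta orb_one x = x.
Proof. by rewrite /theta act_one secK. Qed.

Let theta_T p x : theta (orb_T p) x = dyn (theta p x).
Proof. by rewrite /theta act_T piT. Qed.

Let theta_Tinv p x : theta (orb_Tinv p) x = dyn_inv (theta p x).
Proof. by rewrite /theta act_Tinv piTinv. Qed.

Let theta_mul p q x : theta (orb_mul p q) x = theta p (theta q x).
Proof. by rewrite -[x]secK !thetaE act_mul. Qed.

Let theta_enveloping p : enveloping X (theta p).
Proof.
apply: (@orb_ind [set p | enveloping X (theta p)]) => /=.
- apply: (@closed_comp _ _ theta) => [q _|]; first exact: theta_continuous.
  exact: closed_closure.
- apply: subset_closure; exists 0 => //; apply/funext => x.
  by rewrite theta_one.
- move=> q /enveloping_dyn; congr (enveloping X _).
  by apply/funext => x; rewrite theta_T.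
- move=> q /enveloping_dyn_inv; congr (enveloping X _).
  by apply/funext => x; rewrite theta_Tinv.
Qed.

Let env p : enveloping X := SigSub (mem_set (@theta_enveloping p)).

Let env_continuous : continuous env.
Proof. by apply: set_val_continuousP; exact: theta_continuous. Qed.

(** The image of [theta] is compact, hence closed, and contains every power of [dyn]. *)
Let env_surj (e : enveloping X) : exists p, env p = e.
Proof.
suff : range theta (set_val e) by move=> [p _ pe]; exists p; exact: set_val_inj.
have cl : closed (range theta).
  apply: compact_closed; first exact/ptws_hausdorff/space_hausdorff.
  apply: continuous_compact => //; apply: continuous_subspaceT; exact: theta_continuous.
apply: cl; apply: closure_subset (set_valP e) => _ [n _ <-].
case: n => n /=.
  elim: n => [|n [p _ pE]]; first by exists orb_one => //; apply/funext => x; rewrite theta_one.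
  by exists (orb_T p) => //; apply/funext => x; rewrite theta_T pE.
elim: n => [|n [p _ pE]].
  by exists (orb_Tinv orb_one) => //; apply/funext => x; rewrite theta_Tinv theta_one.
by exists (orb_Tinv p) => //; apply/funext => x; rewrite theta_Tinv pE.
Qed.

Let K : set HN := [set P | exists2 p : orb, set_val p = P & forall x, theta p x = x].

Let K_separates (a b : orb) :
  (forall j x, (forall p q, theta p = theta q -> set_val p j x = set_val q j x) ->
    set_val a j x = set_val b j x) -> theta a = theta b.
Proof.
have orb_eq (p : orb) Q (OQ : one_orbit Q) : set_val p = Q -> p = SigSub (mem_set OQ).
  by move=> pQ; exact: set_val_inj.
have inv (q : orb) : exists q' : orb, orb_mul q' q = orb_one /\ orb_mul q q' = orb_one.
  have [Q' [OQ' h1 h2]] := one_orbit_inv (set_valP q).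
  by exists (SigSub (mem_set OQ')); split; apply: set_val_inj.
have theta_inj (q : orb) x y : theta q x = theta q y -> x = y.
  have [q' [q'q _]] := inv q => /(congr1 (theta q')).
  by rewrite -!theta_mul q'q !theta_one.
have theta_surj (q : orb) x : exists y, theta q y = x.
  have [q' [_ qq']] := inv q; exists (theta q' x).
  by rewrite -theta_mul qq' theta_one.
move=> ab.
have [|||||||k [p <- pK] akb] :=
  @normal_subgroup_separates R K _ _ _ _ _ _ (set_val a) (set_val b)
    (set_valP a) (set_valP b).
- by move=> _ [p <- _]; exact: set_valP.
- have -> : K = set_val @` [set p | forall x, theta p x = x].
    by rewrite eqEsubset; split=> P [p p1 p2]; exists p.
  apply: compact_closed; first exact: HN_hausdorff.
  apply: continuous_compact; first by apply: continuous_subspaceT; exact: set_val_continuous.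
  apply: subclosed_compact orb_compact _ => //.
  rewrite (_ : [set p | _] = \bigcap_x [set p | theta p x = x]); last first.
    by rewrite eqEsubset; split=> p h // x; [move=> _; exact: h|exact: h].
  apply: closed_bigI => x _; apply: closed_eq_hausdorff; first exact: space_hausdorff.
    exact: pi_act_continuous.
  exact: cst_continuous.
- by exists orb_one.
- move=> _ _ [p <- pK] [q <- qK]; exists (orb_mul p q) => // x.
  by rewrite theta_mul qK pK.
- move=> _ [p <- pK]; have [p' [p'p _]] := inv p.
  exists (set_val p'); last by have := congr1 set_val p'p.
  by exists p' => // x; rewrite -[in LHS](pK x) -theta_mul p'p theta_one.
- move=> _ A C [p <- pK] OA OC cE.
  pose a' : orb := SigSub (mem_set OA); pose c' : orb := SigSub (mem_set OC).
  exists c' => // x.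
  have h : orb_mul c' (orb_mul p a') = orb_mul a' p by apply: set_val_inj.
  have [y <-] := theta_surj a' x.
  by have := theta_mul c' (orb_mul p a') y; rewrite h !theta_mul !pK => /esym.
(* If q and q' act alike on X, then q q'^-1 lies in [K], so an invariant coefficient takes the same
   value at both. *)
- move=> j x jx; apply: ab => q q' qq'.
  have [q'' [h1 h2]] := inv q'.
  have Kk : K (set_val (orb_mul q q'')).
    exists (orb_mul q q'') => // y; have [z <-] := theta_surj q' y.
    by rewrite theta_mul -(theta_mul q'' q') h1 theta_one qq'.
  have h1' : star (set_val q'') (set_val q') = star_one R := congr1 set_val h1.
  have <- : star (set_val (orb_mul q q'')) (set_val q') = set_val q.
    change (star (star (set_val q) (set_val q'')) (set_val q') = set_val q).
    by rewrite -(starA _ _ (set_valP q)) h1' star_1r.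
  exact: jx Kk (set_valP q').
have -> : a = orb_mul p b by apply: set_val_inj.
by apply/funext => x; rewrite theta_mul pK.
Qed.

Let envS := enveloping_system X.

Let descends j x := forall p q, theta p = theta q -> set_val p j x = set_val q j x.

(** The coefficient of order j + 1 of (1 + t) p is p_j + p_(j+1), and both it and p_(j+1) depend
    only on [theta p]. *)
Let descends_pred j x : descends j.+1 x -> descends j x.
Proof.
move=> d p q pq; have /d : theta (orb_T p) = theta (orb_T q).
  by apply/funext => y; rewrite !theta_T pq.
rewrite /= !hTS (d _ _ pq) => h; exact: mulIg h.
Qed.

Let lift := projT1 (choice env_surj).
Let liftK e : env (lift e) = e. Proof. exact: (projT2 (choice env_surj)). Qed.

(** The value is read off a chosen preimage; it does not depend on the choice once [descends j x]
    holds. *)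
Let coef j x (e : envS) : circle R := set_val (lift e) j x.

Let coef_env j x p : descends j x -> coef j x (env p) = set_val p j x.
Proof. by apply; exact: (congr1 set_val (liftK (env p))). Qed.

Let coef_continuous j x : descends j x -> continuous (coef j x).
Proof.
move=> d; apply: (continuous_quotient orb_compact (@space_hausdorff envS) env_continuous env_surj).
rewrite (_ : _ \o _ = fun p => set_val p j x); last by apply/funext => p; exact: coef_env.
move=> p; apply: (@continuous_comp _ _ _ set_val (fun P : HN => P j x)).
  exact: set_val_continuous.
exact: seq_eval_continuous.
Qed.

(** On the orbit closure lambda is multiplication by 1 + t, which multiplies the coefficient of
    order j + 1 by the one of order j; the coefficient of order 0 is constantly x. *)
Let coef_quasi_eigen j x : descends j x -> quasi_eigen R envS j (coef j x).
Proof.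
elim: j => [|j IH] d.
  by exists x; apply/funext => e; rewrite /coef one_orbit0//; exact: set_valP.
split; first exact: coef_continuous.
exists (coef j x); first exact/IH/descends_pred.
move=> e; have [p <-] := env_surj e.
have -> : dyn (env p : envS) = env (orb_T p).
  by apply: set_val_inj; apply/funext => y; exact: (esym (theta_T p y)).
by rewrite !coef_env//; exact: descends_pred.
Qed.

Lemma enveloping_quasi_eigens_separate (e f : envS) : e <> f ->
  exists2 g, quasi_eigens R envS g & g e <> g f.
Proof.
have [p <-] := env_surj e; have [q <-] := env_surj f => pq.
apply: contrapT => nsep; apply: pq; apply: set_val_inj; apply: K_separates => j x d.
apply: contrapT => ne; apply: nsep; exists (coef j x).
  by exists j => //; exact: coef_quasi_eigen.
by rewrite !coef_env.
Qed.

End Factor.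

Theorem theorem5p7 (R : realType) (X : dynSys)
  (hX : factor_of X (calH_system R)) :
  quasi_discrete_spectrum R (enveloping_system X).
Proof.
have [pi [pi_continuous pi_surj pi_dyn]] := hX.
apply: quasi_eigens_separate => e f.
apply: (enveloping_quasi_eigens_separate pi_continuous _ pi_dyn).
by move=> x; have [h _ <-] := pi_surj x Logic.I; exists h.
Qed.
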